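(* Let $A \in \mathcal{H}_{\alpha}(\mathbb{R}^{\mathbb{N}})$ and let $A' \in \mathcal{H}_{\alpha}(\overline{\mathbb{R}}^{\mathbb{N}})$ be its unique $\alpha$-Hölder extension. Suppose there exists $z_0 \in \mathbb{R}$ such that $$A'(x_1, \ldots, x_{n-1}, \pm\infty, x_{n+1}, \ldots) < A'(x_1, \ldots, x_{n-1}, z_0, x_{n+1}, \ldots)$$ for all $x \in \overline{\mathbb{R}}^{\mathbb{N}}$, all $n \in \mathbb{N}$ and both choices of sign. Then the family of Gibbs states $(\mu_{\beta A})_{\beta>0}$ has an accumulation point $\mu_{\infty}$ at infinity, i.e. there are $\beta_n\to\infty$ and a Borel probability measure $\mu_\infty$ on $\mathbb{R}^{\mathbb{N}}$ such that $\mu_{\beta_n A}\to\mu_\infty$ weakly.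
   Context: Points of $\mathbb{R}^{\mathbb{N}}$ are $x=(x_1,x_2,\ldots)$; $\sigma$ is the left shift; $ax=(a,x_1,x_2,\ldots)$. The metric on $\mathbb{R}^{\mathbb{N}}$ is $d(x,y)=\sum_{n\ge 1}\frac{1}{\pi 2^n}|\arctan(x_n)-\arctan(y_n)|$. Let $\overline{\mathbb{R}}=\mathbb{R}\cup\{\pm\infty\}$ with $\arctan(\pm\infty)=\pm\pi/2$; the same formula defines a metric $\widehat d$ on $\overline{\mathbb{R}}^{\mathbb{N}}$, which is then a compact metric space. $\mathcal{H}_\alpha(X)$ denotes real-valued $\alpha$-Hölder functions on the metric space $X$ (exponent $\alpha\in(0,1]$ fixed). Every $A\in\mathcal{H}_\alpha(\mathbb{R}^{\mathbb{N}})$ has a unique extension $A'\in\mathcal{H}_\alpha(\overline{\mathbb{R}}^{\mathbb{N}})$. Fix a strictly positive continuous $f:\mathbb{R}\to\mathbb{R}$ with $\int_{\mathbb{R}} f(a)\,da=1$. For $B\in\mathcal{H}_\alpha(\mathbb{R}^{\mathbb{N}})$ the Ruelle operator is $\mathcal{L}_B(\varphi)(x)=\int_{\mathbb{R}} e^{B(ax)}\varphi(ax)f(a)\,da$, with dual $\int\varphi\, d(\mathcal{L}_B^*\mu)=\int\mathcal{L}_B(\varphi)\,d\mu$ for bounded continuous $\varphi$. There are $\lambda_B>0$ (simple) and a strictly positive $\alpha$-Hölder $\psi_B$ with $\mathcal{L}_B\psi_B=\lambda_B\psi_B$; with $\bar B=B+\log\psi_B-\log(\psi_B\circ\sigma)-\log\lambda_B$,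 the Gibbs state $\mu_B$ is the unique $\sigma$-invariant Borel probability measure on $\mathbb{R}^{\mathbb{N}}$ with $\mathcal{L}_{\bar B}^*\mu_B=\mu_B$. This is applied with $B=\beta A$, $\beta>0$. *)

(* Defs.v *)
(* Sequences are indexed from 0: x n stands for the (n+1)-st coordinate. *)
From HB Require Import structures.
From mathcomp Require Import all_boot all_order all_algebra.
From mathcomp Require Import all_classical all_reals all_analysis.

Set Implicit Arguments.
Unset Strict Implicit.
Unset Printing Implicit Defensive.

Import Order.TTheory GRing.Theory Num.Theory.
Import numFieldNormedType.Exports.

Local Open Scope classical_set_scope.
Local Open Scope ring_scope.

(* Aliases of nat -> R and nat -> \bar R, so that the canonical structures
   below (metric d, Borel sigma-algebra) do not compete with the ones that the
   library puts on function types. *)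
Definition rseq (R : realType) : Type := nat -> R.
Definition eseq (R : realType) : Type := nat -> \bar R.

HB.instance Definition _ (R : realType) := Choice.copy (rseq R) (nat -> R).
HB.instance Definition _ (R : realType) := Pointed.copy (rseq R) (nat -> R).
HB.instance Definition _ (R : realType) := Choice.copy (eseq R) (nat -> \bar R).
HB.instance Definition _ (R : realType) := Pointed.copy (eseq R) (nat -> \bar R).

Section distance.
Context {R : realType}.
Implicit Types a b c : nat -> R.

Definition eatan (x : \bar R) : R :=
  match x with
  | r%:E => atan r
  | +oo%E => pi / 2
  | -oo%E => - (pi / 2)
  end.

Definition wdist_term a b (n : nat) : R := (pi * 2 ^+ n.+1)^-1 * `|a n - b n|.

Definition wdist a b : R := limn (series (wdist_term a b)).

Definition rseq_dist (x y : rseq R) : R :=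
  wdist (fun n => atan (x n)) (fun n => atan (y n)).

Definition eseq_dist (x y : eseq R) : R :=
  wdist (fun n => eatan (x n)) (fun n => eatan (y n)).

Let bd a := forall n, `|a n| <= pi / 2.

Lemma wdist_term_ge0 a b n : 0 <= wdist_term a b n.
Proof. by rewrite mulr_ge0// invr_ge0 mulr_ge0 ?pi_ge0// exprn_ge0. Qed.

Lemma is_cvg_wdist a b : bd a -> bd b -> cvgn (series (wdist_term a b)).
Proof.
move=> ba bb; apply: (@series_le_cvg _ _ (geometric 2^-1 2^-1)).
- by move=> n; exact: wdist_term_ge0.
- by move=> n; rewrite /geometric /= mulr_ge0// ?exprn_ge0// invr_ge0.
- move=> n; rewrite /wdist_term /geometric/= exprVn -invfM -exprS invfM mulrC.
  rewrite mulrA ler_piMl ?invr_ge0 ?exprn_ge0//.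
  rewrite ler_pdivrMr ?pi_gt0// mul1r (le_trans (ler_normB _ _))//.
  by rewrite (le_trans (lerD (ba n) (bb n)))// -splitr.
- by apply: is_cvg_geometric_series; rewrite ger0_norm ?invf_lt1 ?ltr1n.
Qed.

Lemma wdistxx a : wdist a a = 0.
Proof.
rewrite /wdist (_ : series _ = cst 0) ?lim_cst//.
apply/funext => n; rewrite /series/= big1// => i _.
by rewrite /wdist_term subrr normr0 mulr0.
Qed.

Lemma wdist_sym a b : wdist a b = wdist b a.
Proof.
by congr (limn (series _)); apply/funext => n; rewrite /wdist_term distrC.
Qed.

Lemma wdist_triangle b a c : bd a -> bd b -> bd c ->
  wdist a c <= wdist a b + wdist b c.
Proof.
move=> ba bb bc.
rewrite /wdist -lim_seriesD; [|exact: is_cvg_wdist|exact: is_cvg_wdist].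
apply: lim_series_le; first exact: is_cvg_wdist.
- by apply: is_cvg_seriesD; exact: is_cvg_wdist.
- move=> n; rewrite /wdist_term /= -mulrDr ler_wpM2l ?ler_distD//.
  by rewrite invr_ge0 mulr_ge0 ?pi_ge0// exprn_ge0.
Qed.

Lemma wdist0_eq a b : bd a -> bd b -> wdist a b = 0 -> forall n, a n = b n.
Proof.
move=> ba bb ab0 n.
have nd : nondecreasing_seq (series (wdist_term a b)).
  by apply/nondecreasing_series => i _ _; exact: wdist_term_ge0.
have := nondecreasing_cvgn_le nd (is_cvg_wdist ba bb) n.+1.
rewrite -/(wdist a b) ab0 /series/= big_nat_recr//= => le0.
have : wdist_term a b n <= 0.
  apply: le_trans le0; rewrite lerDr sumr_ge0// => i _.
  exact: wdist_term_ge0.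
rewrite /wdist_term pmulr_rle0; last first.
  by rewrite invr_gt0 mulr_gt0 ?pi_gt0// exprn_gt0.
by rewrite normr_le0 subr_eq0 => /eqP.
Qed.

Lemma atan_le_pihalf (r : R) : `|atan r| <= pi / 2.
Proof. by rewrite ler_norml (ltW (atan_gtNpi2 r)) (ltW (atan_ltpi2 r)). Qed.

Lemma eatan_le_pihalf (x : \bar R) : `|eatan x| <= pi / 2.
Proof.
case: x => [r| |] /=; rewrite ?normrN; first exact: atan_le_pihalf.
- by rewrite ger0_norm// divr_ge0 ?pi_ge0.
- by rewrite ger0_norm// divr_ge0 ?pi_ge0.
Qed.

Lemma eatan_inj : injective eatan.
Proof.
case=> [r| |] [s| |] //=.
- by move/(congr1 tan); rewrite !atanK => ->.
- by move=> h; have := atan_ltpi2 r; rewrite h ltxx.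
- by move=> h; have := atan_gtNpi2 r; rewrite h ltxx.
- by move=> h; have := atan_ltpi2 s; rewrite -h ltxx.
- have p : 0 < pi / 2 :> R by rewrite divr_gt0 ?pi_gt0.
  by move=> h; move: (p); rewrite h oppr_gt0 => /(lt_trans p); rewrite ltxx.
- by move=> h; have := atan_gtNpi2 s; rewrite -h ltxx.
- have p : 0 < pi / 2 :> R by rewrite divr_gt0 ?pi_gt0.
  by move=> h; move: (p); rewrite -h oppr_gt0 => /(lt_trans p); rewrite ltxx.
Qed.

Lemma rseq_distxx x : rseq_dist x x = 0.
Proof. exact: wdistxx. Qed.

Lemma rseq_dist0_eq x y : rseq_dist x y = 0 -> x = y.
Proof.
move=> xy; apply/funext => n; apply: (can_inj (@atanK R)).
by apply: (wdist0_eq _ _ xy) => k; exact: atan_le_pihalf.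
Qed.

Lemma rseq_dist_sym x y : rseq_dist x y = rseq_dist y x.
Proof. exact: wdist_sym. Qed.

Lemma rseq_dist_triangle y x z :
  rseq_dist x z <= rseq_dist x y + rseq_dist y z.
Proof. by apply: wdist_triangle => k; exact: atan_le_pihalf. Qed.

Lemma eseq_distxx x : eseq_dist x x = 0.
Proof. exact: wdistxx. Qed.

Lemma eseq_dist0_eq x y : eseq_dist x y = 0 -> x = y.
Proof.
move=> xy; apply/funext => n; apply: eatan_inj.
by apply: (wdist0_eq _ _ xy) => k; exact: eatan_le_pihalf.
Qed.

Lemma eseq_dist_sym x y : eseq_dist x y = eseq_dist y x.
Proof. exact: wdist_sym. Qed.

Lemma eseq_dist_triangle y x z :
  eseq_dist x z <= eseq_dist x y + eseq_dist y z.
Proof. by apply: wdist_triangle => k; exact: eatan_le_pihalf. Qed.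

End distance.

HB.instance Definition _ (R : realType) := isMetric.Build R (rseq R)
  rseq_distxx rseq_dist0_eq rseq_dist_sym rseq_dist_triangle.

HB.instance Definition _ (R : realType) := isMetric.Build R (eseq R)
  eseq_distxx eseq_dist0_eq eseq_dist_sym eseq_dist_triangle.

(* The sigma-algebra of rseq R is the Borel one, generated by the open sets of
   the metric rseq_dist. *)
HB.instance Definition _ (R : realType) :=
  @isMeasurable.Build (sigma_display (@open (rseq R))) (rseq R)
    <<s @open (rseq R) >>
    (@sigma_algebra0 _ setT (@open (rseq R)))
    (@sigma_algebraC _ (@open (rseq R)))
    (@sigma_algebra_bigcup _ setT (@open (rseq R))).

Definition holder (R : realType) (alpha : R) (X : metricType R) (g : X -> R)
    : Prop :=
  exists C : R, forall x y : X, `|g x - g y| <= C * mdist x y `^ alpha.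

Definition bounded_continuous (R : realType) (phi : rseq R -> R) : Prop :=
  continuous phi /\ bounded_fun phi.

Section ruelle.
Context {R : realType}.
Implicit Types (f : R -> R) (B phi psi : rseq R -> R).
Implicit Types (mu nu : probability (rseq R) R).

Definition rseq_cons (a : R) (x : rseq R) : rseq R :=
  fun n => if n is k.+1 then x k else a.

Definition rseq_shift (x : rseq R) : rseq R := fun n => x n.+1.

Definition rseq_embed (x : rseq R) : eseq R := fun n => (x n)%:E.

Definition eseq_set (x : eseq R) (n : nat) (v : \bar R) : eseq R :=
  fun k => if k == n then v else x k.

Definition ruelle f B phi (x : rseq R) : R :=
  \int[lebesgue_measure]_a
    (expR (B (rseq_cons a x)) * phi (rseq_cons a x) * f a).

Definition ruelle_dual f B mu nu : Prop :=
  forall phi, bounded_continuous phi ->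
    \int[nu]_x phi x = \int[mu]_x ruelle f B phi x.

Definition ruelle_eigen (alpha : R) f B (lambda : R) psi : Prop :=
  [/\ 0 < lambda, forall x, 0 < psi x, holder alpha psi &
      forall x, ruelle f B psi x = lambda * psi x].

Definition normalized_potential B (lambda : R) psi (x : rseq R) : R :=
  B x + ln (psi x) - ln (psi (rseq_shift x)) - ln lambda.

Definition shift_invariant mu : Prop :=
  forall E : set (rseq R), measurable E -> mu (rseq_shift @^-1` E) = mu E.

(* The eigenvalue is simple and positive eigenfunctions exist for no other
   one, so the normalized potential does not depend on (lambda, psi). *)
Definition gibbs_state (alpha : R) f B mu : Prop :=
  exists lambda psi,
    [/\ ruelle_eigen alpha f B lambda psi, shift_invariant mu &
        ruelle_dual f (normalized_potential B lambda psi) mu mu].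

Definition weak_cvg (mu_ : nat -> probability (rseq R) R) mu : Prop :=
  forall phi, bounded_continuous phi ->
    \int[mu_ n]_x phi x @[n --> \oo] --> \int[mu]_x phi x.

End ruelle.

(* Main.v *)
(* Iterating the eigenvalue equation for [psi] transports a comparison of the
   values of A at two sequences that differ in one coordinate to a comparison of
   the values of [psi]. Replacing a very large coordinate by one close to z0 lowers
   A by at most an error that is summable over the places by the Hoelder bound,
   and in the first place it raises A by nearly some delta > 0, by compactness of
   the extended sequence space. Hence the normalized weight e^(beta A) psi at a
   point a with |a| > M is at most 2 e^(- beta delta / 2) times that at points
   near z0, so mu_(beta A) (|x_0| > M + 1) tends to 0, and by shift invariance
   the same holds for every coordinate. Along a sequence beta_n going to infinity
   the limit must live on the compact cube [- (M + 1), M + 1]^N; it is obtained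
   by coding points by bits, extracting limits of the masses of all finite bit
   cylinders, and realizing these as the law of a random variable on [0, 1[. *)
Require Import Defs.
From HB Require Import structures.
From mathcomp Require Import all_boot all_order all_algebra.
From mathcomp Require Import all_classical all_reals all_analysis.
From mathcomp Require Import measurable_realfun.
From mathcomp Require Import ring lra.
Import Order.TTheory GRing.Theory Num.Theory.
Import numFieldNormedType.Exports.
Local Open Scope classical_set_scope.
Local Open Scope ring_scope.

Set Implicit Arguments.
Unset Strict Implicit.
Unset Printing Implicit Defensive.

(** * Compactness and the metric on sequences *)

(** The obstacle is that [psi] varies with beta, and neither its Hoelder constant nor its lower
    bound is controlled in beta. Iterating the eigenvalue equation pushes the differing coordinate
    so far out that the regularity of [psi] costs only a factor 2, however deep one has to go. All
    other errors come from the Hoelder bound of [A'] and are linear in beta, so the gain of order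
    beta can absorb them. A gap uniform over all places cannot exist, since a coordinate far out
    hardly changes [A']; a definite gap is therefore used at the first place only, and the mere sign
    of the difference elsewhere. In the limit construction, cylinders need not be continuity sets,
    so the limit measure may give a cylinder a mass other than the limit of its masses. Those limits
    serve only as weights of Riemann sums of [phi] at representative points, which are close to both
    integrals. *)

Section extraction.
Context {R : realType}.

(** Tychonoff gives a cluster point [l]; [g n] is an index past [n] at which the first [n]
    coordinates are within [1 / (n + 1)] of [l]. So [g] may fail to be monotone, but [n <= g n]
    suffices for limits along it. *)
Lemma bounded_seq_subcvg (C : nat -> R) (a : nat -> nat -> R) :
    (forall n k, `|a n k| <= C k) ->
  exists (g : nat -> nat) (l : nat -> R), (forall n, (n <= g n)%N) /\
    forall k, (fun n => a (g n) k) @ \oo --> l k.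
Proof.
move=> aC.
pose T := prod_topology (fun _ : nat => R : topologicalType).
have cK : @compact T [set f | forall k, [set x : R | `|x| <= C k] (f k)].
  apply: (@tychonoff nat (fun=> R) (fun k => [set x : R | `|x| <= C k])) => k.
  rewrite (_ : [set _ | _] = `[- C k, C k]%classic); first exact: segment_compact.
  by apply/seteqP; split => x /=; rewrite in_itv/= ler_norml.
pose F : set_system T := (a : nat -> T) @ \oo.
have FK : F [set f | forall k, [set x : R | `|x| <= C k] (f k)].
  by exists 0%N => // n _ k /=; exact: aC.
have [l [_ lF]] := cK F _ FK.
have near_l n : \forall f \near (l : T),
    forall k : 'I_n, `|l (val k) - (f : nat -> R) (val k)| < n.+1%:R^-1.
  pose close (k : 'I_n) (f : T) :=
    `|l (val k) - (f : nat -> R) (val k)| < n.+1%:R^-1.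
  apply: (@filter_forall T 'I_n close (nbhs (l : T)) (nbhs_filter _)) => k.
  have /cvgrPdist_lt : (proj (val k) : T -> R) @ (l : T) --> l (val k).
    exact: proj_continuous.
  exact.
have pick n : exists m, (n <= m)%N /\
    forall k : 'I_n, `|l (val k) - a m (val k)| < n.+1%:R^-1.
  have Fn : F [set a m | m in [set m | (n <= m)%N]].
    by exists n => // m nm; exists m.
  by have [_ [[m nm <-] Hm]] := lF _ _ Fn (near_l n); exists m.
have [g Hg] := choice pick.
exists g, l; split=> [n|k]; first by have [] := Hg n.
apply/cvgrPdist_lt => e e0.
near=> n; have [_ H] := Hg n.
have kn : (k < n)%N by near: n; exact: nbhs_infty_gt.
apply: lt_trans (H (Ordinal kn)) _.
by near: n; exact: near_infty_natSinv_lt (PosNum e0).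
Unshelve. all: by end_near. Qed.

End extraction.

Section wdist_estimates.
Context {R : realType}.
Implicit Types a b : nat -> R.

Let bd a := forall n, `|a n| <= pi / 2.

Lemma wdist_le a b (L : R) : bd a -> bd b ->
  (forall K, series (wdist_term a b) K <= L) -> wdist a b <= L.
Proof.
move=> ba bb abL; apply: limr_le; first exact: is_cvg_wdist.
by apply: nearW.
Qed.

Lemma wdist_term_le a b n : bd a -> bd b -> wdist_term a b n <= wdist a b.
Proof.
move=> ba bb.
have nd : nondecreasing_seq (series (wdist_term a b)).
  by apply/nondecreasing_series => i _ _; exact: wdist_term_ge0.
apply: le_trans (nondecreasing_cvgn_le nd (is_cvg_wdist ba bb) n.+1).
rewrite /series/= big_nat_recr//= lerDr sumr_ge0// => i _.
exact: wdist_term_ge0.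
Qed.

Lemma wdist_coord a b n : bd a -> bd b ->
  `|a n - b n| <= pi * 2 ^+ n.+1 * wdist a b.
Proof.
move=> ba bb; have := wdist_term_le n ba bb; rewrite /wdist_term mulrC.
by rewrite ler_pdivrMr 1?mulrC// mulr_gt0 ?pi_gt0 ?exprn_gt0.
Qed.

Lemma wdist_coord_le a b n : bd a -> bd b -> (forall k, k != n -> a k = b k) ->
  wdist a b <= `|a n - b n| / (pi * 2 ^+ n.+1).
Proof.
move=> ba bb ab; apply: wdist_le => // K.
have t0 i : i != n -> wdist_term a b i = 0.
  by move=> /ab; rewrite /wdist_term => ->; rewrite subrr normr0 mulr0.
have -> : series (wdist_term a b) K = (n < K)%:R * wdist_term a b n.
  elim: K => [|K IH]; first by rewrite /series/= big_nil mul0r.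
  rewrite seriesSr IH ltnS [(n <= K)%N]leq_eqVlt.
  have [<-|nK] := eqVneq n K; first by rewrite ltnn mul0r add0r mul1r.
  by rewrite (t0 K) 1?eq_sym// addr0.
rewrite /wdist_term [X in _ <= X]mulrC ler_piMl//.
  by rewrite wdist_term_ge0.
by case: (n < K)%N.
Qed.

Lemma wdist_close a b m (eta : R) : bd a -> bd b -> 0 <= eta ->
  (forall k, (k < m)%N -> `|a k - b k| <= eta) ->
  wdist a b <= eta + 2^-1 ^+ m.
Proof.
move=> ba bb eta0 ab; apply: wdist_le => // K.
have pi1 : 1 <= pi :> R by rewrite (le_trans _ (pi_ge2 R))// ler1n.
have h0 n : 0 <= 2^-1 ^+ n :> R by rewrite exprn_ge0.
have termE i : wdist_term a b i = 2^-1 ^+ i.+1 * (`|a i - b i| / pi).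
  by rewrite /wdist_term invfM exprVn mulrC mulrA mulrC mulrA mulrAC.
have t1 i : wdist_term a b i <= 2^-1 ^+ i.+1.
  rewrite termE ler_piMr// ler_pdivrMr ?pi_gt0// mul1r.
  rewrite (le_trans (ler_normB _ _))// (le_trans (lerD (ba i) (bb i)))//; lra.
have t2 i : (i < m)%N -> wdist_term a b i <= 2^-1 ^+ i.+1 * eta.
  move=> im; rewrite termE ler_wpM2l// ler_pdivrMr ?pi_gt0//.
  by rewrite (le_trans (ab _ im))// ler_peMr.
(* The weights of the first [m] terms sum to at most 1, and each later term is at most its power of
   1/2; the subtracted powers make the induction go through. *)
suff : series (wdist_term a b) K <= eta * (1 - 2^-1 ^+ K) +
    (if (K <= m)%N then 0 else 2^-1 ^+ m - 2^-1 ^+ K).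
  move=> /le_trans; apply; apply: lerD.
    by rewrite ler_piMr// lerBlDr lerDl.
  by case: ifPn => // _; rewrite lerBlDr lerDl.
elim: K => [|K IH]; first by rewrite /series/= big_nil expr0 subrr mulr0 addr0.
rewrite seriesSr.
have e2 : 2^-1 ^+ K = 2^-1 ^+ K.+1 + 2^-1 ^+ K.+1 :> R.
  by rewrite exprS; lra.
have [Km|mK] := ltnP K m.
  have := t2 _ Km; move: IH; rewrite (ltnW Km) !addr0 e2.
  by move: (2^-1 ^+ K.+1) => q; nra.
have := t1 K; move: IH; case: ifPn => [Km|_].
  have -> : m = K by apply/eqP; rewrite eqn_leq mK Km.
  by rewrite e2; have := h0 K.+1; move: (2^-1 ^+ K.+1) => q; nra.
rewrite e2; have := h0 K.+1; move: (2^-1 ^+ K.+1) => q; nra.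
Qed.

Lemma atan_lipschitz (x y : R) : `|atan x - atan y| <= `|x - y|.
Proof.
wlog yx : x y / y <= x.
  move=> h; have [/h//|/ltW/h] := leP y x.
  by rewrite distrC [X in _ <= X]distrC.
have catan : {within `[y, x], continuous (@atan R)}.
  by apply: continuous_subspaceT => z; exact: continuous_atan.
have [z _ ->] := MVT_segment yx (fun z _ => is_derive1_atan z) catan.
rewrite normrM ler_piMl// ger0_norm.
- by rewrite invf_le1 ?lerDl ?sqr_ge0// ltr_wpDr ?sqr_ge0.
- by rewrite invr_ge0 addr_ge0 ?sqr_ge0.
Qed.

End wdist_estimates.

Section rseq_topology.
Context {R : realType}.
Implicit Types x y : rseq R.

Lemma rseq_dist_coord_le x y n : (forall k, k != n -> x k = y k) ->
  mdist x y <= `|atan (x n) - atan (y n)| / (pi * 2 ^+ n.+1).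
Proof.
move=> xy; apply: (@wdist_coord_le R (atan \o x) (atan \o y)).
- by move=> k; exact: atan_le_pihalf.
- by move=> k; exact: atan_le_pihalf.
- by move=> k /xy /= ->.
Qed.

Lemma eseq_dist_coord_le (x y : eseq R) n : (forall k, k != n -> x k = y k) ->
  mdist x y <= `|eatan (x n) - eatan (y n)| / (pi * 2 ^+ n.+1).
Proof.
move=> xy; apply: (@wdist_coord_le R (eatan \o x) (eatan \o y)).
- by move=> k; exact: eatan_le_pihalf.
- by move=> k; exact: eatan_le_pihalf.
- by move=> k /xy /= ->.
Qed.

Lemma rseq_dist_close x y m (eta : R) : 0 <= eta ->
  (forall k, (k < m)%N -> `|x k - y k| <= eta) ->
  mdist x y <= eta + 2^-1 ^+ m.
Proof.
move=> eta0 xy; apply: (@wdist_close R (atan \o x) (atan \o y)) => //.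
- by move=> k; exact: atan_le_pihalf.
- by move=> k; exact: atan_le_pihalf.
- by move=> k km /=; rewrite (le_trans (atan_lipschitz _ _))// xy.
Qed.

Lemma eseq_dist_close (x y : eseq R) m (eta : R) : 0 <= eta ->
  (forall k, (k < m)%N -> `|eatan (x k) - eatan (y k)| <= eta) ->
  mdist x y <= eta + 2^-1 ^+ m.
Proof.
move=> eta0 xy; apply: (@wdist_close R (eatan \o x) (eatan \o y)) => //.
- by move=> k; exact: eatan_le_pihalf.
- by move=> k; exact: eatan_le_pihalf.
Qed.

Lemma rseq_dist_le1 x y : mdist x y <= 1.
Proof.
by have := @rseq_dist_close x y 0 0; rewrite add0r expr0; apply.
Qed.

(** The metric controls [atan (x k)] only; [tan] is continuous on the values of [atan] and recovers
    the coordinate. *)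
Lemma rseq_coord_continuous k : continuous (fun x : rseq R => x k).
Proof.
move=> x.
have -> : (fun x : rseq R => x k) = tan \o (fun x : rseq R => atan (x k)).
  by apply/funext => y /=; rewrite atanK.
apply: continuous_comp; last first.
  apply: continuous_tan; rewrite gt_eqF// cos_gt0_pihalf//.
  by rewrite atan_gtNpi2 atan_ltpi2.
apply/(@cvgrPdist_lt _ _ _ _ (nbhs_filter x)) => e e0.
have c0 : 0 < pi * 2 ^+ k.+1 :> R by rewrite mulr_gt0 ?pi_gt0 ?exprn_gt0.
have : nbhs x [set y | mdist x y < e / (pi * 2 ^+ k.+1)].
  rewrite -metricType_numDomainType.nbhs_nbhs_mdist.
  by exists (e / (pi * 2 ^+ k.+1)) => //=; rewrite divr_gt0.
apply: (@filterS _ _ (nbhs_filter x)) => y /=.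
rewrite ltr_pdivlMr// mulrC; apply: le_lt_trans.
by apply: (@wdist_coord R (atan \o x) (atan \o y)) => n; exact: atan_le_pihalf.
Qed.

Lemma halfX_small (e : R) : 0 < e -> exists m, 2^-1 ^+ m < e.
Proof.
move=> e0; have /cvgrPdist_lt/(_ _ e0) : geometric 1 2^-1 n @[n --> \oo] --> (0 : R).
  by apply: cvg_geometric; rewrite ger0_norm ?invf_lt1 ?ltr1n.
move=> [n _ /(_ n (leqnn n))].
by rewrite /= sub0r normrN /geometric/= mul1r ger0_norm ?exprn_ge0//; exists n.
Qed.

Lemma rseq_nbhs_cylinder (P : set (rseq R)) x : nbhs x P ->
  exists m (eta : R), 0 < eta /\
    forall y, (forall k, (k < m)%N -> `|x k - y k| <= eta) -> P y.
Proof.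
rewrite -metricType_numDomainType.nbhs_nbhs_mdist => -[e /= e0 eP].
have [m me] := @halfX_small (e / 2) ltac:(by rewrite divr_gt0).
exists m, (e / 2 / 2); split; first by rewrite !divr_gt0.
move=> y xy; apply: eP => /=.
apply: le_lt_trans (rseq_dist_close _ xy) _; first by rewrite !divr_ge0 ?ltW.
by lra.
Qed.

End rseq_topology.

(** * Weak limits of measures concentrating on a cube *)

Section rseq_measurability.
Context {R : realType}.

Lemma rseq_open_measurable (U : set (rseq R)) : open U -> measurable U.
Proof. by move=> oU; exact: sub_sigma_algebra. Qed.

Lemma rseq_closed_measurable (U : set (rseq R)) : closed U -> measurable U.
Proof.
by move/closed_openC/rseq_open_measurable/measurableC; rewrite setCK.
Qed.

Lemma rseq_continuous_measurable (phi : rseq R -> R) :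
  continuous phi -> measurable_fun setT phi.
Proof.
move=> /continuousP cphi.
apply: (measurability _ (RGenOpens.measurableE R)).
move=> _ [_ [a [b ->] <-]]; rewrite setTI.
apply: rseq_open_measurable; apply: cphi; exact: interval_open.
Qed.

End rseq_measurability.

Section finite_valued.
Context d (T : measurableType d) (R : realType) (P : probability T R).

Lemma probability_integrable (h : T -> R) (C : R) : measurable_fun setT h ->
  (forall x, `|h x| <= C) -> P.-integrable setT (EFin \o h).
Proof.
move=> mh hC; apply: measurable_bounded_integrable => //.
- exact: le_lt_trans (probability_le1 P measurableT) (ltry 1).
- exists C; split; first exact: num_real.
  by move=> r /ltW Cr x _ /=; exact: le_trans (hC x) _.
Qed.

Lemma le_norm_Rintegral_probability (h : T -> R) (C : R) :
  measurable_fun setT h -> (forall x, `|h x| <= C) ->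
  `|\int[P]_x h x| <= C.
Proof.
move=> mh hC; have ih := probability_integrable mh hC.
apply: le_trans (le_normr_Rintegral _ ih) _ => //.
rewrite [leRHS](_ : C = \int[P]_x C); last first.
  by rewrite Rintegral_cst//= probability_setT mulr1.
apply: le_Rintegral => //.
- by apply: integrable_abse ih.
- by apply: (@probability_integrable _ `|C|).
Qed.

Variables (I : choiceType) (G : T -> I).
Hypothesis mG : forall s, measurable (G @^-1` [set s]).

(** The set [Y] is arbitrary, so anything computed from finitely many bits is measurable. *)
Lemma finite_valued_preimage (r : seq I) (Y : set I) :
  (forall x, G x \in r) -> measurable (G @^-1` Y).
Proof.
move=> Gr.
rewrite (_ : _ @^-1` _ = \big[setU/set0]_(s <- r | `[< Y s >]) (G @^-1` [set s])).
  by apply: bigsetU_measurable.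
rewrite -bigcup_seq_cond; apply/seteqP; split => x /=.
  by move=> Yx; exists (G x) => //=; rewrite Gr; exact/asboolP.
by move=> -[s /= /andP[_ /asboolP Ys] ->].
Qed.

Lemma finite_valued_measurable (r : seq I) (c : I -> R) :
  (forall x, G x \in r) -> measurable_fun setT (c \o G).
Proof.
by move=> Gr _ Y mY; rewrite setTI comp_preimage; exact: finite_valued_preimage Gr.
Qed.

Lemma Rintegral_finite_valued (r : seq I) (c : I -> R) : uniq r ->
  (forall x, G x \in r) ->
  \int[P]_x c (G x) = \sum_(s <- r) c s * fine (P (G @^-1` [set s])).
Proof.
move=> ur Gr.
have mi s : measurable_fun setT (\1_(G @^-1` [set s]) : T -> R).
  exact: measurable_indic.
have i1 s x : `|\1_(G @^-1` [set s]) x : R| <= 1.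
  by rewrite indicE; case: (_ \in _); rewrite ?normr1 ?normr0.
pose S r x := \sum_(s <- r) c s * (\1_(G @^-1` [set s]) x : R).
have iS r0 : P.-integrable setT (EFin \o S r0) /\
    \int[P]_x S r0 x = \sum_(s <- r0) c s * fine (P (G @^-1` [set s])).
  elim: r0 => [|s r0 [IH1 IH2]].
    have -> : S [::] = cst 0 by apply/funext => x; rewrite /S big_nil.
    rewrite big_nil Rintegral_cst// mul0r; split=> //.
    by apply: (@probability_integrable _ 0) => // x; rewrite normr0.
  have is1 : P.-integrable setT (EFin \o (\1_(G @^-1` [set s]) : T -> R)).
    exact: probability_integrable.
  have isc : P.-integrable setT (EFin \o (fun x => c s * \1_(G @^-1` [set s]) x)).
    apply: (@probability_integrable _ `|c s|); first exact: measurable_funM.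
    by move=> x; rewrite normrM ler_piMr.
  have ES : S (s :: r0) = (fun x => c s * \1_(G @^-1` [set s]) x + S r0 x).
    by apply/funext => x; rewrite /S big_cons.
  rewrite ES; split; first exact: (integrableD measurableT isc IH1).
  rewrite RintegralD// IH2 big_cons RintegralZl//.
  by rewrite /Rintegral integral_indic// setIT.
rewrite -(iS r).2//; congr fine; apply: eq_integral => x _; congr EFin.
rewrite /S (bigD1_seq (G x))//= big1.
  by rewrite indicE mem_set// mulr1 addr0.
by move=> s /eqP sG; rewrite indicE memNset ?mulr0//= => /esym.
Qed.

End finite_valued.

(** * Realizing prescribed cylinder masses on the unit interval *)

Section unit_probability.
Context {R : realType}.

Definition unit_prob : set _ -> \bar R :=
  mrestr lebesgue_measure (measurable_itv (`[0, 1[ : interval R)).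

Let unit_prob0 : unit_prob set0 = 0%E.
Proof. exact: measure0. Qed.

Let unit_prob_ge0 A : (0 <= unit_prob A)%E.
Proof. exact: measure_ge0. Qed.

Let unit_prob_sigma_additive : semi_sigma_additive unit_prob.
Proof. exact: measure_semi_sigma_additive. Qed.

HB.instance Definition _ := isMeasure.Build _ _ _ unit_prob
  unit_prob0 unit_prob_ge0 unit_prob_sigma_additive.

Let unit_prob_setT : unit_prob setT = 1%:E.
Proof.
by rewrite /unit_prob /mrestr setTI lebesgue_measure_itv/= lte01 sube0.
Qed.

HB.instance Definition _ :=
  Measure_isProbability.Build _ _ _ unit_prob unit_prob_setT.

End unit_probability.

(* Cutting [0, 1[ into consecutive intervals of lengths p [:: false] and
   p [:: true], then each of these in the same way, and so on, makes the
   sequence of positions of a uniform point a random binary sequence whose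
   cylinders have the prescribed probabilities p s. *)
Section bit_tree.
Context {R : realType} (p : seq bool -> R).
Hypothesis p_ge0 : forall s, 0 <= p s.
Hypothesis p_nil : p [::] = 1.
Hypothesis p_split : forall s, p s = p (rcons s false) + p (rcons s true).

(** Left endpoint of the interval of [s]. The fold carries the prefix read so far; entering a [true]
    child skips the length of its [false] sibling. *)
Definition tree_lo (s : seq bool) : R :=
  (foldl (fun (acc : seq bool * R) b =>
     (rcons acc.1 b, acc.2 + (if b then p (rcons acc.1 false) else 0)))
   ([::], 0) s).2.

Fixpoint tree_bits (u : R) (n : nat) : seq bool :=
  if n is n'.+1 then
    rcons (tree_bits u n')
      (tree_lo (tree_bits u n') + p (rcons (tree_bits u n') false) <= u)
  else [::].

Lemma tree_lo_rcons s b :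
  tree_lo (rcons s b) = tree_lo s + (if b then p (rcons s false) else 0).
Proof.
have fst : (foldl (fun (acc : seq bool * R) b => (rcons acc.1 b,
    acc.2 + (if b then p (rcons acc.1 false) else 0))) ([::], 0) s).1 = s.
  by elim/last_ind: s => //= s c IH; rewrite foldl_rcons/= IH.
by rewrite /tree_lo foldl_rcons/= fst.
Qed.

Lemma size_tree_bits u n : size (tree_bits u n) = n.
Proof. by elim: n => //= n IH; rewrite size_rcons IH. Qed.

Lemma take_tree_bits u m n : (m <= n)%N -> take m (tree_bits u n) = tree_bits u m.
Proof.
elim: n => [|n IH]; first by rewrite leqn0 => /eqP ->.
rewrite leq_eqVlt => /orP[/eqP ->|]; first by rewrite take_oversize// size_tree_bits.
by rewrite ltnS => mn; rewrite /= -cats1 takel_cat ?size_tree_bits// IH.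
Qed.

(** Closed left ends and open right ends make the two child intervals partition their parent, so
    each bit is decided by position. *)
Lemma tree_bitsP u s : 0 <= u < 1 ->
  tree_bits u (size s) = s <-> tree_lo s <= u < tree_lo s + p s.
Proof.
move=> u01; elim/last_ind: s => [|s b IH].
  by rewrite /tree_lo/= add0r p_nil.
rewrite size_rcons/= tree_lo_rcons.
have p0 := p_ge0 (rcons s false); have p1 := p_ge0 (rcons s true).
have ps := p_split s.
split.
  move=> /rcons_inj[us].
  move: (us); rewrite IH us => /andP[lu ul].
  case: b => [sb|/negbT]; first by rewrite sb -addrA -ps.
  by rewrite -ltNge addr0 lu => ->.
move=> lu; have us : tree_bits u (size s) = s.
  apply/IH; move: lu.
  by case: b => /andP[]; rewrite ?addr0 => ? ?; apply/andP; split; lra.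
rewrite us; congr (rcons _ _); move: lu; case: b => /andP[]//.
by rewrite addr0 => _; rewrite ltNge => /negbTE.
Qed.

Lemma tree_lo_bounds s : 0 <= tree_lo s /\ tree_lo s + p s <= 1.
Proof.
elim/last_ind: s => [|s b [IH1 IH2]]; first by rewrite /tree_lo/= add0r p_nil.
rewrite tree_lo_rcons.
have p0 := p_ge0 (rcons s false); have p1 := p_ge0 (rcons s true).
have ps := p_split s.
by case: b; rewrite ?addr0; split; lra.
Qed.

(* Points outside [0, 1[ are treated as 0 so that the bits always lie in a
   cylinder of positive mass. *)
Definition unit_bits (n : nat) (u : R) : seq bool :=
  tree_bits (if 0 <= u < 1 then u else 0) n.

Let fold01 (u : R) : 0 <= (if 0 <= u < 1 then u else 0) < 1.
Proof. by case: ifPn => // _; rewrite lexx ltr01. Qed.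

(** A half-open interval that contains a point has positive length. *)
Lemma unit_bits_gt0 n u : 0 < p (unit_bits n u).
Proof.
have := (tree_bitsP (unit_bits n u) (fold01 u)).1.
rewrite {1}/unit_bits size_tree_bits => /(_ erefl) /andP[a b].
by have := le_lt_trans a b; rewrite ltrDl.
Qed.

Lemma unit_bits_itv s : unit_bits (size s) @^-1` [set s] `&` `[0, 1[ =
  `[tree_lo s, (tree_lo s + p s)[%classic.
Proof.
have [l0 l1] := tree_lo_bounds s.
apply/seteqP; split => u /=; rewrite !in_itv/=.
  by rewrite /unit_bits => -[+ u01]; rewrite u01 => /(tree_bitsP _ u01).
move=> /andP[lu ul]; have u01 : 0 <= u < 1.
  by rewrite (le_trans l0 lu) (lt_le_trans ul l1).
by split => //; rewrite /unit_bits u01; apply/(tree_bitsP _ u01); rewrite lu.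
Qed.

Lemma unit_bits_measurable n s : measurable (unit_bits n @^-1` [set s]).
Proof.
have [<-|ns] := eqVneq (size s) n; last first.
  rewrite (_ : _ @^-1` _ = set0)//; apply/seteqP; split => u //= us.
  by move: ns; rewrite -us /unit_bits size_tree_bits eqxx.
(* All points outside [[0, 1[] share the bits of 0, so the preimage is an interval, possibly with
   the whole complement added. *)
have E : unit_bits (size s) @^-1` [set s] =
    (`[tree_lo s, (tree_lo s + p s)[%classic : set R) `|`
    (if unit_bits (size s) 0 == s then ~` `[0, 1[%classic else set0).
  rewrite -unit_bits_itv; apply/seteqP; split => u /=.
    move=> us; have [u01|u01] := boolP (0 <= u < 1).
      by left; split => //; rewrite in_itv.
    right; move: us; rewrite /unit_bits (negbTE u01) lexx ltr01 => -> /=.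
    by rewrite eqxx /=; rewrite in_itv/=; exact/negP.
  case=> [[]//|]; case: ifPn => //= /eqP u0; rewrite in_itv/= => /negP/negbTE u01.
  by move: u0; rewrite /unit_bits u01 lexx ltr01.
rewrite E; apply: measurableU => //.
by case: ifPn => // _; exact: measurableC.
Qed.

Lemma unit_bits_prob s :
  unit_prob (unit_bits (size s) @^-1` [set s]) = (p s)%:E.
Proof.
rewrite /unit_prob /mrestr unit_bits_itv lebesgue_measure_itv/= lte_fin ltrDl.
case: ifPn => [_|]; first by rewrite -EFinB addrAC subrr add0r.
by rewrite -leNgt => ps0; rewrite (_ : p s = 0)//; apply/eqP; rewrite eq_le ps0 p_ge0.
Qed.

End bit_tree.

(** * Binary coding of points of the cube *)

Section coding.
Context {R : realType} (M : R).
Hypothesis M_gt0 : 0 < M.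

Definition clamp (t : R) : R := Num.max (- M) (Num.min t M).

Definition rseq_clamp (x : rseq R) : rseq R := fun k => clamp (x k).

Lemma clamp_norm t : `|clamp t| <= M.
Proof.
rewrite ler_norml /clamp le_max lexx/= ge_max ge_min lexx orbT andbT.
by rewrite (le_trans _ (ltW M_gt0))// oppr_le0 ltW.
Qed.

Lemma clamp_id t : `|t| <= M -> clamp t = t.
Proof.
by rewrite ler_norml /clamp => /andP[Mt tM]; rewrite min_l// max_r.
Qed.

(* The triples (k, N, l) are enumerated through [pickle]; finitely many of these
   tests locate a clamped coordinate of x up to 1 / (N + 1). *)
Definition test (x : rseq R) (i : nat) : bool :=
  if unpickle i is Some (k, N, l) then l%:R / N.+1%:R - M <= x k else false.

Definition bits (m : nat) (x : rseq R) : seq bool := mkseq (test x) m.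

Lemma test_pickle x k N l : test x (pickle (k, N, l)) = (l%:R / N.+1%:R - M <= x k).
Proof. by rewrite /test pickleK. Qed.

(** If the clamped values were more than [1 / (N + 1)] apart, a grid threshold would separate them:
    the largest one not exceeding the larger value. *)
Lemma clamp_test_le (s t : R) (N : nat) :
  (forall l, (l <= Num.truncn (2 * M * N.+1%:R))%N ->
     (l%:R / N.+1%:R - M <= s) = (l%:R / N.+1%:R - M <= t)) ->
  `|clamp s - clamp t| <= N.+1%:R^-1.
Proof.
wlog st : s t / clamp t <= clamp s.
  move=> h H; have [/h|/ltW/h] := leP (clamp t) (clamp s); first exact.
  by rewrite distrC; apply=> l /H ->.
move=> H; rewrite ger0_norm ?subr_ge0// leNgt; apply/negP => lt.
have N0 : 0 < N.+1%:R :> R by rewrite ltr0n.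
have := clamp_norm s; have := clamp_norm t.
rewrite !ler_norml => /andP[tM Mt] /andP[sM Ms].
pose y := (clamp s + M) * N.+1%:R.
have y0 : 0 <= y by apply: mulr_ge0 (ltW N0); lra.
have /andP[ly yl] := truncn_itv y0.
set l := Num.truncn y in ly yl.
have lL : (l <= Num.truncn (2 * M * N.+1%:R))%N.
  by apply: le_truncn; apply: ler_wpM2r (ltW N0) _ _ _; lra.
have vs : l%:R / N.+1%:R - M <= clamp s.
  by rewrite lerBlDr ler_pdivrMr.
have vt : clamp t < l%:R / N.+1%:R - M.
  apply: (@lt_le_trans _ _ (clamp s - N.+1%:R^-1)).
    by rewrite ltrBrDr addrC -ltrBrDr.
  have -> : clamp s = y / N.+1%:R - M by rewrite /y mulfK ?gt_eqF// addrK.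
  rewrite addrAC lerD2r lerBlDr -[X in _ + X]mul1r -mulrDl natr1.
  by rewrite ler_pM2r ?invr_gt0// ltW.
have := H _ lL.
(* The threshold lies above [- M] and not above [M], so comparing it with the raw coordinate or with
   the clamped one gives the same answer. *)
have -> : (l%:R / N.+1%:R - M <= s) = true.
  have v0 : - M < l%:R / N.+1%:R - M by exact: le_lt_trans tM vt.
  move: vs; rewrite /clamp le_max leNgt v0/= le_min => /andP[-> _//].
suff -> : (l%:R / N.+1%:R - M <= t) = false by [].
apply/negbTE; rewrite -ltNge.
move: vt; rewrite /clamp gt_max => /andP[_]; rewrite gt_min => /orP[//|].
by rewrite ltNge (le_trans vs Ms).
Qed.

Lemma bits_clamp_close (K N : nat) : exists m0, forall m x y, (m0 <= m)%N ->
  bits m x = bits m y ->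
  forall k, (k < K)%N -> `|clamp (x k) - clamp (y k)| <= N.+1%:R^-1.
Proof.
pose L := Num.truncn (2 * M * N.+1%:R).
exists (\max_(k < K) \max_(l < L.+1) pickle (val k, N, val l)).+1.
move=> m x y m0m bxy k kK; apply: clamp_test_le => l lL.
have kl : (pickle (k, N, l) < m)%N.
  apply: leq_trans m0m; rewrite ltnS.
  pose F (k : 'I_K) := \max_(l < L.+1) pickle (val k, N, val l).
  apply: leq_trans (@leq_bigmax _ F (Ordinal kK)).
  exact: (@leq_bigmax _ (fun l : 'I_L.+1 => pickle (k, N, val l))
    (Ordinal (lL : (l < L.+1)%N))).
rewrite -!test_pickle.
by rewrite -(nth_mkseq false (test x) kl) -(nth_mkseq false (test y) kl) -/(bits m x) bxy.
Qed.

Lemma size_bits m x : size (bits m x) = m.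
Proof. exact: size_mkseq. Qed.

Lemma take_bits m n x : (m <= n)%N -> take m (bits n x) = bits m x.
Proof. by move=> mn; rewrite /bits /mkseq -map_take take_iota (minn_idPl mn). Qed.

Lemma test_measurable i b : measurable [set x | test x i = b].
Proof.
have m1 : measurable [set x | test x i].
  rewrite /test; case: unpickle => [[[k N] l]|]; last first.
    by rewrite (_ : [set _ | _] = set0)//; apply/seteqP; split.
  apply: rseq_closed_measurable.
  have := (@closed_comp _ _ (fun x : rseq R => x k) [set t | l%:R / N.+1%:R - M <= t]).
  apply; first by move=> x _; exact: rseq_coord_continuous.
  exact: closed_ge.
case: b => //.
rewrite (_ : [set _ | _] = ~` [set x | test x i]); first exact: measurableC.
by apply/seteqP; split => x /=; case: test.
Qed.

Lemma bits_measurable m s : measurable (bits m @^-1` [set s]).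
Proof.
elim: m s => [|m IH] s.
  have [->|s0] := eqVneq s [::].
    by rewrite (_ : _ @^-1` _ = setT)//; apply/seteqP; split.
  rewrite (_ : _ @^-1` _ = set0)//; apply/seteqP; split => x //= /esym/eqP.
  by rewrite (negbTE s0).
case/lastP: s => [|s b].
  by rewrite (_ : _ @^-1` _ = set0)//; apply/seteqP; split => x //=.
have -> : bits m.+1 @^-1` [set rcons s b] =
    bits m @^-1` [set s] `&` [set x | test x m = b].
  apply/seteqP; split => x /=; rewrite /bits mkseqS; first by move/rcons_inj => [].
  by move=> [-> ->].
by apply: measurableI; [exact: IH|exact: test_measurable].
Qed.

Definition cylinder (s : seq bool) : set (rseq R) := bits (size s) @^-1` [set s].

Lemma cylinderP m s x : size s = m -> cylinder s x <-> bits m x = s.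
Proof. by move=> <-. Qed.

Lemma cylinder_split s :
  cylinder s = cylinder (rcons s false) `|` cylinder (rcons s true).
Proof.
rewrite /cylinder !size_rcons; apply/seteqP; split => x /=; rewrite /bits mkseqS.
  by move=> ->; case: test; [right|left].
by case=> /rcons_inj[].
Qed.

Lemma cylinder_disj s :
  [disjoint cylinder (rcons s false) & cylinder (rcons s true)].
Proof.
apply/disj_setPS => x [] /=; rewrite /cylinder !size_rcons /bits /= => ->.
by move/rcons_inj => [].
Qed.

Definition all_bits (m : nat) : seq (seq bool) :=
  [seq val t | t <- enum {: m.-tuple bool}].

Lemma mem_all_bits m s : size s = m -> s \in all_bits m.
Proof.
move=> sm; apply/mapP; exists (Tuple (introT eqP sm)) => //.
by rewrite mem_enum.
Qed.

Lemma uniq_all_bits m : uniq (all_bits m).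
Proof. by rewrite map_inj_uniq ?enum_uniq//; exact: val_inj. Qed.

Lemma size_mem_all_bits m s : s \in all_bits m -> size s = m.
Proof. by move=> /mapP[t _ ->]; rewrite size_tuple. Qed.

End coding.

Section compact_uniform.
Context {R : realType}.

(** In a sequence of counterexamples the cube points have a coordinatewise limit [l], which their
    partners approach too, contradicting continuity at [l]. Only [z] is confined to the cube: it
    will be compared with points that are bounded by [M] in the first [K] coordinates alone. *)
Lemma continuous_uniform_on_cube (M : R) (phi : rseq R -> R) (e : R) :
  continuous phi -> 0 < e ->
  exists K (tau : R), 0 < tau /\ forall z x : rseq R, (forall k, `|z k| <= M) ->
    (forall k, (k < K)%N -> `|z k - x k| <= tau) -> `|phi z - phi x| <= e.
Proof.
move=> cphi e0; apply: contrapT => noK.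
have bad n : exists zx : rseq R * rseq R, [/\ forall k, `|zx.1 k| <= M,
    forall k, (k < n)%N -> `|zx.1 k - zx.2 k| <= n.+1%:R^-1 &
    e < `|phi zx.1 - phi zx.2|].
  apply: contrapT => nozx; apply: noK; exists n, n.+1%:R^-1; split => // z x zM zx.
  by rewrite leNgt; apply/negP => exz; apply: nozx; exists (z, x).
have [zx Hzx] := choice bad.
have [|g [l [gn gl]]] := @bounded_seq_subcvg R (fun=> M) (fun n => (zx n).1).
  by move=> n k; have [+ _ _] := Hzx n; exact.
have nl : nbhs (l : rseq R) [set y | `|phi l - phi y| < e / 2].
  have := @cvgr_dist_lt _ _ _ _ (nbhs_filter (l : rseq R)) phi (phi l) (cphi l).
  by apply; rewrite divr_gt0.
have [K [eta [eta0 Keta]]] := rseq_nbhs_cylinder nl.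
have : \forall n \near \oo, [/\ (K <= n)%N, n.+1%:R^-1 < eta / 2 &
    forall k : 'I_K, `|l k - (zx (g n)).1 k| < eta / 2].
  near=> n; split.
  - by near: n; exact: nbhs_infty_ge.
  - by near: n; apply: (near_infty_natSinv_lt (PosNum _)); rewrite divr_gt0.
  - near: n; apply: filter_forall => k.
    by have /cvgrPdist_lt := gl k; apply; rewrite divr_gt0.
move=> [n _ /(_ n (leqnn n))] [Kn ne Hn].
have [_ zxn] := Hzx (g n); rewrite ltNge => /negP; apply.
have ne' : (g n).+1%:R^-1 < eta / 2.
  by apply: le_lt_trans ne; rewrite lef_pV2 ?posrE// ler_nat ltnS.
have Hz : `|phi l - phi (zx (g n)).1| < e / 2.
  apply: Keta => k kK; apply: le_trans (ltW (Hn (Ordinal kK))) _.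
  by rewrite ler_pdivrMr// ler_peMr ?ltW// ltr1n.
have Hx : `|phi l - phi (zx (g n)).2| < e / 2.
  apply: Keta => k kK.
  rewrite (_ : l k - _ = l k - (zx (g n)).1 k +
    ((zx (g n)).1 k - (zx (g n)).2 k)); last by ring.
  apply: le_trans (ler_normD _ _) _.
  have h1 := Hn (Ordinal kK); have /= h2 := zxn k (leq_trans kK (leq_trans Kn (gn n))).
  by rewrite [leRHS]splitr lerD// ltW// (le_lt_trans h2).
rewrite (_ : _ - _ = - (phi l - phi (zx (g n)).1) +
  (phi l - phi (zx (g n)).2)); last by ring.
apply: le_trans (ler_normD _ _) _.
by rewrite normrN [leRHS]splitr lerD// ltW.
Unshelve. all: by end_near. Qed.

End compact_uniform.

Section limit_variable.
Context {R : realType} (M : R) (p : seq bool -> R).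
Hypothesis M_gt0 : 0 < M.
Hypothesis p_ge0 : forall s, 0 <= p s.
Hypothesis p_nil : p [::] = 1.
Hypothesis p_split : forall s, p s = p (rcons s false) + p (rcons s true).
Hypothesis p_cylinder : forall s, 0 < p s -> cylinder M s !=set0.

Definition cylinder_point (s : seq bool) : rseq R := xget point (cylinder M s).

Definition approx (m : nat) (u : R) : rseq R :=
  rseq_clamp M (cylinder_point (unit_bits p m u)).

Definition limit_variable (u : R) : rseq R :=
  fun k => limn (fun m => approx m u k).

(** The bits produced have positive mass, so their cylinder is nonempty and the default value of
    [xget] never occurs. *)
Lemma cylinder_point_bits m u :
  bits M m (cylinder_point (unit_bits p m u)) = unit_bits p m u.
Proof.
have /p_cylinder/(xgetPex point) : 0 < p (unit_bits p m u) by exact: unit_bits_gt0.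
by rewrite -/(cylinder_point _) /cylinder /= /unit_bits size_tree_bits.
Qed.

(** All approximations from stage [m0] on share their first [m0] bits, so they are Cauchy in each
    coordinate, uniformly in [u]. *)
Lemma limit_variable_close K N : exists m0, forall m u, (m0 <= m)%N ->
  forall k, (k < K)%N -> `|limit_variable u k - approx m u k| <= N.+1%:R^-1.
Proof.
have cauchy K' N' : exists m0, forall m m' u, (m0 <= m)%N -> (m0 <= m')%N ->
    forall k, (k < K')%N -> `|approx m u k - approx m' u k| <= N'.+1%:R^-1.
  have [m0 Hm0] := bits_clamp_close M_gt0 K' N'.
  exists m0 => m m' u mm0 mm0' k kK; apply: (Hm0 m0) => //.
  rewrite -(take_bits _ _ mm0) -(take_bits _ _ mm0') !cylinder_point_bits.
  by rewrite /unit_bits !take_tree_bits.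
have [m0 Hm0] := cauchy K N; exists m0 => m u mm0 k kK.
have cv : cvgn (fun m => approx m u k).
  apply: cauchy_cvg; apply/cauchy_ballP => e e0.
  have [N' _ /(_ _ (leqnn _)) N'e] := near_infty_natSinv_lt (PosNum e0).
  have [m1 Hm1] := cauchy k.+1 N'.
  rewrite near_map2; exists ([set n | m1 <= n]%N, [set n | m1 <= n]%N) => /=.
    by split; exists m1.
  move=> [a b] /= [ma mb]; rewrite /ball/=.
  exact: le_lt_trans (Hm1 _ _ _ ma mb _ (ltnSn k)) N'e.
have cvd : (fun m' => `|approx m' u k - approx m u k|) @ \oo -->
    `|limit_variable u k - approx m u k|.
  by apply: cvg_norm; apply: cvgB; [exact: cv|exact: cvg_cst].
rewrite -(cvg_lim _ cvd)//; apply: limr_le; first by apply/cvg_ex; eexists; exact: cvd.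
by exists m0 => // m' mm0'; exact: Hm0.
Qed.

Lemma limit_variable_norm u k : `|limit_variable u k| <= M.
Proof.
apply/ler_addgt0Pr => e e0.
have [N _ /(_ _ (leqnn _)) Ne] := near_infty_natSinv_lt (PosNum e0).
have [m /(_ m u (leqnn m) k (ltnSn k)) H] := limit_variable_close k.+1 N.
rewrite -[limit_variable u k](subrK (approx m u k)) addrC.
apply: le_trans (ler_normD _ _) _; apply: lerD; first exact: clamp_norm.
by apply: le_trans H (ltW Ne).
Qed.

Lemma approx_measurable m (Y : set (rseq R)) : measurable (approx m @^-1` Y).
Proof.
rewrite (_ : approx m = (fun s => rseq_clamp M (cylinder_point s)) \o unit_bits p m)//.
rewrite comp_preimage.
apply: (@finite_valued_preimage _ _ _ (unit_bits p m) _ (all_bits m)).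
  by move=> s; exact: unit_bits_measurable.
by move=> u; rewrite mem_all_bits// /unit_bits size_tree_bits.
Qed.

Lemma approx_cvg u (e : R) : 0 < e ->
  exists m0, forall m, (m0 <= m)%N -> mdist (limit_variable u) (approx m u) < e.
Proof.
move=> e0; have [K Ke] := halfX_small (divr_gt0 e0 (ltr0Sn _ 1)).
have e20 : 0 < e / 2 by rewrite divr_gt0.
have [N _ /(_ _ (leqnn _)) Ne] := near_infty_natSinv_lt (PosNum e20).
have [m0 Hm0] := limit_variable_close K N.
exists m0 => m mm0; apply: le_lt_trans (rseq_dist_close _ (Hm0 m u mm0)) _ => //.
by rewrite [ltRHS]splitr ltrD.
Qed.

Lemma limit_variable_measurable : measurable_fun setT limit_variable.
Proof.
apply: (@measurability _ _ _ _ _ _ (@open (rseq R))) => //.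
move=> _ [U oU <-]; rewrite setTI.
(* The limit is in [U] exactly when, for some [j], the approximations are eventually in [V j]; these
   preimages are measurable because each approximation has finitely many values. *)
pose V j := [set x : rseq R | forall y, mdist x y < j.+1%:R^-1 -> U y].
have -> : limit_variable @^-1` U =
    \bigcup_j \bigcup_n \bigcap_m (approx (n + m) @^-1` V j).
  apply/seteqP; split => u /=.
    move=> Uu; have := open_nbhs_nbhs (conj oU Uu).
    rewrite -metricType_numDomainType.nbhs_nbhs_mdist => -[e /= e0 eU].
    have e20 : 0 < e / 2 by rewrite divr_gt0.
    have [j _ /(_ _ (leqnn _)) je] := near_infty_natSinv_lt (PosNum e20).
    have [n Hn] := approx_cvg u e20.
    exists j => //; exists n => // m _ y /= xy; apply: eU => /=.
    apply: le_lt_trans (@metric_triangle _ (rseq R) _ (approx (n + m) u) _) _.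
    by rewrite [ltRHS]splitr ltrD ?Hn ?leq_addr// (lt_trans xy).
  move=> [j _ [n _ H]].
  have [m Hm] := @approx_cvg u j.+1%:R^-1 ltac:(by rewrite invr_gt0).
  by apply: (H m I); rewrite metric_sym; apply: Hm; exact: leq_addl.
apply: bigcupT_measurable => j; apply: bigcupT_measurable => n.
by apply: bigcapT_measurable => m; exact: approx_measurable.
Qed.

End limit_variable.

Section weak_limit.
Context {R : realType} (M : R).
Hypothesis M_gt0 : 0 < M.

Definition outside (k : nat) : set (rseq R) := [set x | M < `|x k|].

Lemma outside_measurable k : measurable (outside k).
Proof.
apply: rseq_open_measurable.
have := (@open_comp _ _ (fun x : rseq R => `|x k|) [set t | M < t]).
apply; last exact: open_gt.
move=> x _; apply: (@continuous_comp _ _ _ (fun x : rseq R => x k) Num.norm).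
  exact: rseq_coord_continuous.
exact: norm_continuous.
Qed.

Let bad (K : nat) : set (rseq R) := \big[setU/set0]_(k < K) outside k.

Let bad_measurable K : measurable (bad K).
Proof. by apply: bigsetU_measurable => k _; exact: outside_measurable. Qed.

Let bad_cvg0 (mu_ : nat -> probability (rseq R) R) K :
  (forall k, fine (mu_ n (outside k)) @[n --> \oo] --> 0) ->
  fine (mu_ n (bad K)) @[n --> \oo] --> 0.
Proof.
move=> H; elim: K => [|K IH].
  rewrite /bad big_ord0; under eq_fun do rewrite measure0.
  exact: cvg_cst.
have Hs : fine (mu_ n (bad K)) + fine (mu_ n (outside K)) @[n --> \oo] --> (0 : R).
  by rewrite -[X in _ --> X](addr0 0); apply: cvgD.
apply: (squeeze_cvgr _ (cvg_cst (0 : R)) Hs); apply: nearW => n.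
rewrite fine_ge0 ?measure_ge0//=.
have mK := outside_measurable K.
rewrite -lee_fin EFinD !fineK ?fin_num_measure// /bad big_ord_recr/=.
have := measureU2 (mu_ n) (bad_measurable K) mK; exact.
Qed.

(* Outside a set of vanishing mass the coordinates that matter for [phi] lie
   in [-M, M], where a long enough cylinder determines [phi] up to an error. *)
Lemma tight_weak_cvg_subseq (mu_ : nat -> probability (rseq R) R) :
  (forall k, fine (mu_ n (outside k)) @[n --> \oo] --> 0) ->
  exists (g : nat -> nat) (mu_oo : probability (rseq R) R),
    (forall n, (n <= g n)%N) /\ weak_cvg (mu_ \o g) mu_oo.
Proof.
move=> mu0.
(* The masses of all cylinders, listed by code, form one bounded sequence for each [n], so a single
   extraction handles them all. *)
pose a n i := if @unpickle (seq bool) i is Some s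
  then fine (mu_ n (cylinder M s)) else 0.
have mcyl s : measurable (cylinder M s) by exact: bits_measurable.
have [|g [l [gn gl]]] := @bounded_seq_subcvg R (fun=> 1) a.
  move=> n i; rewrite /a; case: unpickle => [s|]; last by rewrite normr0.
  rewrite ger0_norm ?fine_ge0 ?measure_ge0// -lee_fin fineK ?fin_num_measure//.
  exact: probability_le1.
pose p (s : seq bool) := l (pickle s).
have pcvg s : fine (mu_ (g n) (cylinder M s)) @[n --> \oo] --> p s.
  by have := gl (pickle s); rewrite /a pickleK.
have p_ge0 s : 0 <= p s.
  rewrite -(cvg_lim _ (pcvg s))//; apply: limr_ge.
    by apply/cvg_ex; eexists; exact: pcvg.
  by apply: nearW => n; rewrite fine_ge0.
have p_nil : p [::] = 1.
  rewrite -(cvg_lim _ (pcvg [::]))//.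
  rewrite (_ : (fun n => _) = cst 1) ?lim_cst//; apply/funext => n /=.
  rewrite (_ : cylinder M [::] = setT) ?probability_setT//.
  by apply/seteqP; split.
have p_split s : p s = p (rcons s false) + p (rcons s true).
  rewrite -(cvg_lim _ (pcvg s))//.
  rewrite (_ : (fun n => _) = (fun n => fine (mu_ (g n) (cylinder M (rcons s false)))) \+
      (fun n => fine (mu_ (g n) (cylinder M (rcons s true))))).
    by apply: cvg_lim => //; apply: cvgD; exact: pcvg.
  apply/funext => n /=.
  rewrite (cylinder_split M s) measureU//=; last first.
    by apply/disj_set2P; exact: cylinder_disj.
  by rewrite fineD ?fin_num_measure.
have p_cyl s : 0 < p s -> cylinder M s !=set0.
  move=> ps; apply/set0P/eqP => s0; move: ps.
  rewrite -(cvg_lim _ (pcvg s))// s0 (_ : (fun n => _) = cst 0) ?lim_cst// ?ltxx//.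
  by apply/funext => n /=; rewrite measure0.
have mX : @measurable_fun _ _ (measurableTypeR R) (rseq R) setT (limit_variable M p) :=
  limit_variable_measurable M_gt0 p_ge0 p_nil p_split p_cyl.
pose X : {mfun measurableTypeR R >-> rseq R} :=
  @mfun_Sub _ _ (measurableTypeR R) (rseq R) _ (mem_set mX).
pose mu_oo : probability (rseq R) R := distribution unit_prob X.
exists g, mu_oo; split => // phi [cphi bphi].
have [B B0 HB] : exists2 B : R, 0 <= B & forall x, `|phi x| <= B.
  have [B0 [_ HB]] := bphi; exists (Num.max 0 (B0 + 1)); first by rewrite le_max lexx.
  by move=> x; rewrite le_max (HB (B0 + 1)) ?ltrDl ?orbT.
have mphi := rseq_continuous_measurable cphi.
apply/cvgrPdist_lt => e e0.
(* Four errors: discretizing [phi] under the limit law, discretizing it under [mu_ n], convergence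
   of the finite sum, and the mass of [bad K]. *)
have [e' e'0 e4] : exists2 e', 0 < e' & e = 4 * e'.
  by exists (e / 4); [rewrite divr_gt0|rewrite mulrC divfK// pnatr_eq0].
have [K [tau [tau0 Ktau]]] := continuous_uniform_on_cube M cphi e'0.
have [N _ /(_ _ (leqnn _)) Ntau] := near_infty_natSinv_lt (PosNum tau0).
have [m1 Hm1] := bits_clamp_close M_gt0 K N.
have [m2 Hm2] := limit_variable_close M_gt0 p_ge0 p_nil p_split p_cyl K N.
pose m := maxn m1 m2.
pose c s := phi (rseq_clamp M (cylinder_point M s)).
pose S := \sum_(s <- all_bits m) c s * p s.
have cB s : `|c s| <= B by exact: HB.
have clampM (x : rseq R) k : `|rseq_clamp M x k| <= M by exact: clamp_norm.
have Hoo : `|\int[mu_oo]_x phi x - S| <= e'.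
  have -> : \int[mu_oo]_x phi x = \int[unit_prob]_u phi (limit_variable M p u).
    rewrite /Rintegral integral_distribution//; first exact/measurable_EFinP.
    apply: (@probability_integrable _ _ _ _ _ B) => //.
    exact: measurableT_comp.
  have -> : S = \int[unit_prob]_u c (unit_bits p m u).
    rewrite (@Rintegral_finite_valued _ _ _ _ _ _ _ (all_bits m)).
    - rewrite /S !big_seq; apply: eq_bigr => s /size_mem_all_bits sm.
      have := unit_bits_prob p_ge0 p_nil p_split s; rewrite sm => ps.
      by congr (_ * _); exact: (esym (congr1 fine ps)).
    - by move=> s; exact: unit_bits_measurable.
    - exact: uniq_all_bits.
    - by move=> u; rewrite mem_all_bits// /unit_bits size_tree_bits.
  have mc : measurable_fun setT (c \o unit_bits p m).
    apply: (@finite_valued_measurable _ _ _ _ _ _ (all_bits m)).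
      by move=> s; exact: unit_bits_measurable.
    by move=> u; rewrite mem_all_bits// /unit_bits size_tree_bits.
  rewrite -RintegralB//; first last.
  - by apply: (@probability_integrable _ _ _ _ _ B).
  - by apply: (@probability_integrable _ _ _ _ _ B) => //; exact: measurableT_comp.
  apply: le_norm_Rintegral_probability.
    by apply: measurable_funB => //; exact: measurableT_comp.
  move=> u; apply: Ktau => [k|k kK].
    by apply: limit_variable_norm.
  by apply: le_trans (ltW Ntau); apply: Hm2 => //; exact: leq_maxr.
have Hn n : `|\int[mu_ n]_x phi x -
    \sum_(s <- all_bits m) c s * fine (mu_ n (cylinder M s))| <=
    e' + 2 * B * fine (mu_ n (bad K)).
  have -> : \sum_(s <- all_bits m) c s * fine (mu_ n (cylinder M s)) =
      \int[mu_ n]_x c (bits M m x).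
    rewrite (@Rintegral_finite_valued _ _ _ _ _ _ _ (all_bits m)).
    - rewrite !big_seq; apply: eq_bigr => s /size_mem_all_bits sm.
      by rewrite /cylinder sm.
    - by move=> s; exact: bits_measurable.
    - exact: uniq_all_bits.
    - by move=> x; rewrite mem_all_bits// size_bits.
  have mc : measurable_fun setT (c \o bits M m).
    apply: (@finite_valued_measurable _ _ _ _ _ _ (all_bits m)).
      by move=> s; exact: bits_measurable.
    by move=> x; rewrite mem_all_bits// size_bits.
  have i1 : (mu_ n).-integrable setT (EFin \o phi).
    exact: (@probability_integrable _ _ _ _ _ B).
  have i2 : (mu_ n).-integrable setT (EFin \o (c \o bits M m)).
    by apply: (probability_integrable _ mc) => x; exact: cB.
  rewrite -RintegralB//; apply: le_trans (le_normr_Rintegral _ _) _ => //.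
    apply: (@probability_integrable _ _ _ _ _ (B + B)); first exact: measurable_funB.
    by move=> x; rewrite (le_trans (ler_normB _ _))// lerD//; exact: cB.
  have i3 : (mu_ n).-integrable setT (EFin \o (\1_(bad K) : rseq R -> R)).
    apply: (@probability_integrable _ _ _ _ _ 1); first exact: measurable_indic.
    by move=> x; rewrite indicE; case: (_ \in _); rewrite ?normr1 ?normr0.
  have -> : e' + 2 * B * fine (mu_ n (bad K)) = \int[mu_ n]_x (e' + 2 * B * \1_(bad K) x).
    rewrite RintegralD//.
    - rewrite RintegralZl// Rintegral_cst//= probability_setT mulr1.
      by rewrite [in RHS]/Rintegral integral_indic// setIT.
    - by apply: (@probability_integrable _ _ _ _ _ `|e'|).
    - by apply: (integrableZl measurableT _ i3).
  apply: le_Rintegral => //.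
  - apply: (@probability_integrable _ _ _ _ _ (B + B)).
      by apply: measurableT_comp => //; exact: measurable_funB.
    by move=> x; rewrite normr_id (le_trans (ler_normB _ _))// lerD//; exact: cB.
  - apply: (@probability_integrable _ _ _ _ _ (e' + 2 * B)).
      apply: measurable_funD => //.
      by apply: measurable_funM => //; exact: measurable_indic.
    by move=> x; rewrite indicE; case: (_ \in _); rewrite ger0_norm /=; lra.
  move=> x _ /=; rewrite indicE; case: (boolP (x \in bad K)) => [_|].
    rewrite mulr1 (le_trans (ler_normB _ _))//.
    have := HB x; have := cB (bits M m x); lra.
  rewrite mulr0 addr0 => /negP xbad.
  have xM k : (k < K)%N -> `|x k| <= M.
    move=> kK; rewrite leNgt; apply/negP => Mx; apply: xbad; rewrite inE /bad.
    by rewrite -bigcup_mkord; exists k.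
  rewrite distrC; apply: Ktau => // k kK.
  rewrite -[x k](clamp_id (xM k kK)); apply: le_trans (ltW Ntau).
  apply: (Hm1 m) => //; first exact: leq_maxl.
  (* The point [x] lies in its own cylinder, so the chosen representative has the same bits as
     [x]. *)
  have nonempty : cylinder M (bits M m x) !=set0.
    by exists x; apply/(cylinderP _ _ (size_bits M m x)).
  exact/(cylinderP _ _ (size_bits M m x))/(xgetPex point nonempty).
have Scvg : (\sum_(s <- all_bits m) c s *
    fine (mu_ (g n) (cylinder M s))) @[n --> \oo] --> S.
  apply: cvg_big => [|s _]; first exact: add_continuous.
  by apply: cvgM; [exact: cvg_cst|exact: pcvg].
have gcvg : g n @[n --> \oo] --> \oo.
  by move=> Y [n0 _ n0Y]; exists n0 => // n n0n; apply: n0Y; exact: leq_trans n0n (gn n).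
have badcvg : 2 * B * fine (mu_ (g n) (bad K)) @[n --> \oo] --> (0 : R).
  rewrite -[X in _ --> X](mulr0 (2 * B)); apply: cvgM; first exact: cvg_cst.
  exact: (cvg_comp _ _ gcvg (bad_cvg0 K mu0)).
near=> n.
have h1 : `|S - \sum_(s <- all_bits m) c s * fine (mu_ (g n) (cylinder M s))| < e'.
  by near: n; move/cvgrPdist_lt : Scvg; apply.
have h2 : `|0 - 2 * B * fine (mu_ (g n) (bad K))| < e'.
  by near: n; move/cvgrPdist_lt : badcvg; apply.
have h3 := Hn (g n); rewrite sub0r normrN in h2.
have {}h2 := le_lt_trans (ler_norm _) h2.
move: Hoo h1 h3; rewrite !ler_norml !ltr_norml /=.
move: (\sum_(s <- all_bits m) _) => S' /andP[? ?] /andP[? ?] /andP[? ?].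
by apply/andP; split; lra.
Unshelve. all: by end_near. Qed.

End weak_limit.

(** * Hoelder functions on the extended sequence space *)

Section hoelder_functions.
Context {R : realType} (alpha : R).
Hypothesis alpha_gt0 : 0 < alpha.

Lemma holder_ge0 (X : metricType R) (g : X -> R) : holder alpha g ->
  exists2 C : R, 0 <= C & forall x y, `|g x - g y| <= C * mdist x y `^ alpha.
Proof.
move=> [C HC]; exists `|C| => // x y; apply: le_trans (HC x y) _.
by rewrite ler_wpM2r ?powR_ge0 ?ler_norm.
Qed.

Lemma holder_continuous (X : metricType R) (g : X -> R) :
  holder alpha g -> continuous g.
Proof.
move=> /holder_ge0[C C0 HC] x; apply/(@cvgrPdist_le _ _ _ _ (nbhs_filter x)) => e e0.
have C1 : 0 < C + 1 by rewrite ltr_wpDl.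
pose d := (e / (C + 1)) `^ alpha^-1.
have d0 : 0 < d by rewrite /d powR_gt0// divr_gt0.
have : nbhs x [set y | mdist x y < d].
  by rewrite -metricType_numDomainType.nbhs_nbhs_mdist; exists d.
apply: (@filterS _ _ (nbhs_filter x)) => y /= xy; apply: le_trans (HC x y) _.
have : mdist x y `^ alpha <= d `^ alpha.
  by rewrite (ge0_ler_powR (ltW alpha_gt0)) ?nnegrE ?mdist_ge0// ltW.
rewrite /d -powRrM mulVf ?gt_eqF// powRr1 ?(divr_ge0 (ltW e0) (ltW C1))// => de.
apply: (@le_trans _ _ ((C + 1) * (e / (C + 1)))).
  by apply: ler_pM => //; rewrite ?powR_ge0// lerDl.
by rewrite mulrC divfK// gt_eqF.
Qed.

Lemma powR_le1 (t : R) : 0 <= t <= 1 -> t `^ alpha <= 1.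
Proof.
move=> /andP[t0 t1]; apply: (@le_trans _ _ (1 `^ alpha)); last by rewrite powR1.
by apply: (ge0_ler_powR (ltW alpha_gt0)); rewrite ?nnegrE ?ler01.
Qed.

Lemma holder_bounded (g : rseq R -> R) : holder alpha g ->
  exists2 B : R, 0 <= B & forall x, `|g x| <= B.
Proof.
move=> /holder_ge0[C C0 HC]; exists (`|g point| + C); first by rewrite addr_ge0.
move=> x; rewrite -[g x](subrK (g point)) addrC.
apply: le_trans (ler_normD _ _) _; rewrite lerD2l (le_trans (HC _ _))//.
by rewrite ler_piMr// powR_le1// mdist_ge0 rseq_dist_le1.
Qed.

Lemma half_powR_lt1 : 2^-1 `^ alpha < 1 :> R.
Proof.
apply: (@lt_le_trans _ _ (1 `^ alpha)); last by rewrite powR1.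
by apply: (gt0_ltr_powR alpha_gt0); rewrite ?nnegrE ?invr_ge0 ?invf_lt1 ?ltr1n.
Qed.

(** Turns the metric weight of a coordinate into geometric decay of ratio [2^-alpha], which makes
    errors summable over places. *)
Lemma half_powR (rho : R) n (t : R) : 0 <= rho -> 0 <= t -> t <= pi * rho ->
  (t / (pi * 2 ^+ n)) `^ alpha <= rho `^ alpha * (2^-1 `^ alpha) ^+ n.
Proof.
move=> rho0 t0 trho.
have -> : (2^-1 `^ alpha) ^+ n = (2^-1 ^+ n) `^ alpha.
  by rewrite -!powR_mulrn ?powR_ge0// -!powRrM mulrC.
rewrite -powRM ?exprn_ge0//.
apply: ge0_ler_powR (ltW alpha_gt0) _ _ _ _ _; rewrite ?nnegrE//.
- by rewrite divr_ge0// mulr_ge0 ?pi_ge0 ?exprn_ge0.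
- by rewrite mulr_ge0 ?exprn_ge0.
rewrite invfM -exprVn mulrA ler_wpM2r ?exprn_ge0//.
by rewrite ler_pdivrMr ?pi_gt0// mulrC.
Qed.

End hoelder_functions.

Section penalty_gap.
Context {R : realType} (alpha : R).
Hypothesis alpha_gt0 : 0 < alpha.
Variable A' : eseq R -> R.
Hypothesis hA' : holder alpha A'.

Lemma eatan_surj (t : R) : `|t| <= pi / 2 -> exists x : \bar R, eatan x = t.
Proof.
rewrite ler_norml => /andP[]; rewrite le_eqVlt => /orP[/eqP <- _|t1].
  by exists -oo%E.
rewrite le_eqVlt => /orP[/eqP ->|t2]; first by exists +oo%E.
by exists (tan t)%:E => /=; rewrite tanK// in_itv/= t1.
Qed.

(** Through [eatan] the space becomes a product of copies of the closed interval from [- pi / 2] to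
    [pi / 2]. *)
Lemma eseq_compact (x_ : nat -> eseq R) : exists (g : nat -> nat) (x : eseq R),
  (forall n, (n <= g n)%N) /\ x_ \o g @ \oo --> x.
Proof.
have [|g [l [gn gl]]] := @bounded_seq_subcvg R (fun=> pi / 2) (fun n k => eatan (x_ n k)).
  by move=> n k; exact: eatan_le_pihalf.
have lpi k : `|l k| <= pi / 2.
  have h : (fun n => `|eatan (x_ (g n) k)|) @ \oo --> `|l k|.
    by apply: cvg_norm; exact: gl.
  rewrite -(cvg_lim _ h)//.
  apply: limr_le; first by apply/cvg_ex; eexists; exact: h.
  by apply: nearW => n; exact: eatan_le_pihalf.
have [x Hx] := choice (fun k => eatan_surj (lpi k)).
exists g, (x : eseq R); split => //.
apply/metricType_numDomainType.cvgrPdist_lt => e e0.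
have e20 : 0 < e / 2 by rewrite divr_gt0.
have [K Ke] := halfX_small e20.
near=> n.
apply: (@le_lt_trans _ _ (e / 2 + 2^-1 ^+ K)); last by rewrite [ltRHS]splitr ltrD2l.
apply: eseq_dist_close => [|k kK]; first exact: ltW.
have : forall k : 'I_K, `|l k - eatan (x_ (g n) k)| <= e / 2.
  near: n; apply: filter_forall => i.
  by have /cvgrPdist_le := gl i; apply.
by move=> /(_ (Ordinal kK)); rewrite /= Hx.
Unshelve. all: by end_near. Qed.

Lemma eseq_set_dist (x y : eseq R) n v :
  mdist (eseq_set x n v) (eseq_set y n v) <= mdist x y.
Proof.
rewrite /mdist/= /eseq_dist; have bd (z : eseq R) k := eatan_le_pihalf (z k).
apply: wdist_le => // K.
apply: le_trans (_ : series (wdist_term (eatan \o x) (eatan \o y)) K <= _).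
  rewrite /series/=; apply: ler_sum => i _; rewrite /wdist_term /eseq_set.
  case: ifPn => //= _; rewrite subrr normr0 mulr0.
  by rewrite mulr_ge0// invr_ge0 mulr_ge0 ?pi_ge0 ?exprn_ge0.
apply: (@nondecreasing_cvgn_le _ (series (wdist_term (eatan \o x) (eatan \o y)))).
  by apply/nondecreasing_series => i _ _; exact: wdist_term_ge0.
by apply: is_cvg_wdist => k; exact: eatan_le_pihalf.
Qed.

(** Otherwise points where the difference is below [1 / (n + 1)] would accumulate at a point where
    it is at most 0, against strictness. *)
Lemma compact_gap (v w : \bar R) :
  (forall x, A' (eseq_set x 0 v) < A' (eseq_set x 0 w)) ->
  exists2 delta : R, 0 < delta &
    forall x, A' (eseq_set x 0 v) + delta <= A' (eseq_set x 0 w).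
Proof.
move=> vw; apply: contrapT => nodelta.
have ex_x n : exists x : eseq R,
    A' (eseq_set x 0 w) < A' (eseq_set x 0 v) + n.+1%:R^-1.
  apply: contrapT => nox; apply: nodelta.
  by exists n.+1%:R^-1 => // x; rewrite leNgt; apply/negP => ?; apply: nox; exists x.
have [x_ Hx_] := choice ex_x.
have [g [x [gn gx]]] := eseq_compact x_.
have cA := holder_continuous alpha_gt0 hA'.
have cvs u : (fun n => A' (eseq_set (x_ (g n)) 0 u)) @ \oo --> A' (eseq_set x 0 u).
  apply: (@cvg_comp _ _ _ (fun n => eseq_set (x_ (g n)) 0 u) A'); last exact: cA.
  apply/metricType_numDomainType.cvgrPdist_lt => e e0.
  move/metricType_numDomainType.cvgrPdist_lt : gx => /(_ _ e0).
  by apply: filterS => n; apply: le_lt_trans; exact: eseq_set_dist.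
have h : (fun n => A' (eseq_set (x_ (g n)) 0 w) - A' (eseq_set (x_ (g n)) 0 v)) @ \oo -->
    A' (eseq_set x 0 w) - A' (eseq_set x 0 v) by apply: cvgB; exact: cvs.
have : A' (eseq_set x 0 w) - A' (eseq_set x 0 v) <= 0.
  apply/ler_addgt0Pl => e e0; rewrite addr0 -(cvg_lim _ h)//; apply: limr_le.
    by apply/cvg_ex; eexists; exact: h.
  have := near_infty_natSinv_lt (PosNum e0); apply: filterS => n /= ne.
  rewrite lerBlDl (le_trans (ltW (Hx_ (g n))))// lerD2l (le_trans _ (ltW ne))//.
  by rewrite lef_pV2 ?posrE// ler_nat ltnS.
by rewrite subr_le0 leNgt vw.
Qed.

End penalty_gap.

Section coordinate_comparison.
Context {R : realType} (alpha : R).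
Hypothesis alpha_gt0 : 0 < alpha.
Variables (A : rseq R -> R) (A' : eseq R -> R) (C : R).
Hypothesis C_ge0 : 0 <= C.
Hypothesis hA' : forall x y, `|A' x - A' y| <= C * mdist x y `^ alpha.
Hypothesis A'_ext : forall x, A' (rseq_embed x) = A x.

Lemma coordinate_comparison (v : \bar R) (z0 rho : R) n (x y : rseq R) :
  0 <= rho -> (forall k, k != n -> x k = y k) ->
  `|eatan v - atan (x n)| <= pi * rho -> `|atan z0 - atan (y n)| <= pi * rho ->
  A x <= A y + 2 * C * rho `^ alpha * (2^-1 `^ alpha) ^+ n.+1 +
    (A' (eseq_set (rseq_embed x) n v) - A' (eseq_set (rseq_embed x) n z0%:E)).
Proof.
move=> rho0 xy xv yz.
(* Used with [u = x], [w = v] and with [u = y], [w = z0]: moving the coordinate exactly to its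
   target costs half of the error each time. *)
have H (u : rseq R) w : (forall k, k != n -> x k = u k) ->
    `|eatan w - atan (u n)| <= pi * rho ->
    `|A' (eseq_set (rseq_embed x) n w) - A u| <=
      C * rho `^ alpha * (2^-1 `^ alpha) ^+ n.+1.
  move=> xu uw; rewrite -A'_ext (le_trans (hA' _ _))// -mulrA ler_wpM2l//.
  apply: (le_trans _ (half_powR alpha_gt0 n.+1 rho0 (normr_ge0 _) uw)).
  apply: ge0_ler_powR (ltW alpha_gt0) _ _ _ _ _; rewrite ?nnegrE ?mdist_ge0//.
    by rewrite divr_ge0// mulr_ge0 ?pi_ge0 ?exprn_ge0.
  apply: le_trans (@eseq_dist_coord_le _ _ _ n _) _.
    by move=> k kn; rewrite /eseq_set (negbTE kn) /rseq_embed xu.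
  by rewrite /eseq_set eqxx.
have := H x v (fun _ _ => erefl) xv; have := H y z0%:E xy yz.
move: (A' _) (A' _) => a b; rewrite !ler_norml -!mulrA.
by move: (C * _) => q /andP[? ?] /andP[? ?]; lra.
Qed.

End coordinate_comparison.

(** * Eigenfunctions and tails of Gibbs states *)

Section density.
Context {R : realType} (f : R -> R).
Hypothesis f_gt0 : forall a, 0 < f a.
Hypothesis f_cont : continuous f.
Hypothesis f_int : (\int[lebesgue_measure]_a (f a)%:E = 1)%E.

Let mf : measurable_fun setT f := continuous_measurable_fun f_cont.

Lemma density_integrable : lebesgue_measure.-integrable setT (EFin \o f).
Proof.
apply/integrableP; split; first exact/measurable_EFinP.
rewrite (_ : (\int[_]_x _)%E = (\int[lebesgue_measure]_a (f a)%:E)%E).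
  by rewrite f_int ltry.
by apply: eq_integral => x _ /=; rewrite gtr0_norm.
Qed.

Lemma weighted_integrable (h : R -> R) (C : R) : measurable_fun setT h ->
  (forall a, `|h a| <= C) ->
  lebesgue_measure.-integrable setT (EFin \o (fun a => h a * f a)).
Proof.
move=> mh hC.
have bh : [bounded h x | x in [set: R]].
  exists C; split; first exact: num_real.
  by move=> r /ltW Cr x _ /=; exact: le_trans (hC x) _.
exact: (@integrableMr _ (measurableTypeR R) R lebesgue_measure setT measurableT
  h (EFin \o f) mh bh density_integrable).
Qed.

Lemma weighted_le (h1 h2 : R -> R) (C : R) :
  measurable_fun setT h1 -> measurable_fun setT h2 ->
  (forall a, `|h1 a| <= C) -> (forall a, `|h2 a| <= C) ->
  (forall a, h1 a <= h2 a) ->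
  \int[lebesgue_measure]_a (h1 a * f a) <= \int[lebesgue_measure]_a (h2 a * f a).
Proof.
move=> m1 m2 b1 b2 h12; apply: le_Rintegral => //.
- exact: weighted_integrable b1.
- exact: weighted_integrable b2.
- by move=> a _; rewrite ler_wpM2r// ltW.
Qed.

Lemma weighted_scale (h : R -> R) (C c : R) : measurable_fun setT h ->
  (forall a, `|h a| <= C) ->
  \int[lebesgue_measure]_a (c * h a * f a) =
  c * \int[lebesgue_measure]_a (h a * f a).
Proof.
move=> mh hC; rewrite -RintegralZl//; last exact: weighted_integrable hC.
by apply: eq_Rintegral => a _; rewrite mulrA.
Qed.

Lemma weighted_cst (c : R) : \int[lebesgue_measure]_a (c * f a) = c.
Proof.
rewrite RintegralZl//; last exact: density_integrable.
by rewrite /Rintegral f_int mulr1.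
Qed.

(** The constant is the mass of the window under [f]. It is fixed before [h], so one value serves
    all beta. *)
Lemma window_mass (z0 eta : R) : 0 < eta -> exists2 c : R, 0 < c &
  forall (h : R -> R) (C m : R), measurable_fun setT h ->
    (forall a, `|h a| <= C) -> 0 <= m -> (forall a, 0 <= h a) ->
    (forall a, `|a - z0| <= eta -> m <= h a) ->
    m * c <= \int[lebesgue_measure]_a (h a * f a).
Proof.
move=> eta0.
pose I : set R := `[z0 - eta, z0 + eta]%classic.
have mI : measurable I by exact: measurable_itv.
have inI a : (a \in I) = (`|a - z0| <= eta).
  by rewrite /I; apply/idP/idP; rewrite inE/= in_itv/= ler_distl.
have m1 : measurable_fun setT (\1_I : R -> R) by exact: measurable_indic.
have b1 a : `|\1_I a| <= 1 :> R.
  by rewrite indicE; case: (_ \in _); rewrite ?normr1 ?normr0.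
exists (\int[lebesgue_measure]_a (\1_I a * f a)).
  have f0 : 0 < f z0 / 2 by rewrite divr_gt0.
  have /cvgrPdist_lt/(_ _ f0) : f @ z0 --> f z0 by exact: f_cont.
  move=> /nbhs_ballP[d /= d0 dP].
  pose r := Num.min eta (d / 2).
  have r0 : 0 < r by rewrite lt_min eta0 divr_gt0.
  pose J : set R := `[z0 - r, z0 + r]%classic.
  have inJ a : (a \in J) = (`|a - z0| <= r).
    by rewrite /J; apply/idP/idP; rewrite inE/= in_itv/= ler_distl.
  have mJ : measurable J by exact: measurable_itv.
  have mu_J : lebesgue_measure J = (2 * r)%:E.
    rewrite /J lebesgue_measure_itv/= lte_fin ltrD2l gtrN// -EFinB.
    by congr EFin; ring.
  have iJ : lebesgue_measure.-integrable setT (EFin \o (\1_J : R -> R)).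
    exact: integrable_indic_itv.
  apply: (@lt_le_trans _ _ (\int[lebesgue_measure]_a (f z0 / 2 * \1_J a))).
    rewrite RintegralZl// mulr_gt0//.
    rewrite /Rintegral integral_indic// setIT [X in 0 < X](congr1 fine mu_J).
    by rewrite /= mulr_gt0.
  apply: le_Rintegral => //.
  - exact: (integrableZl measurableT _ iJ).
  - exact: weighted_integrable b1.
  move=> a _; rewrite !indicE inI inJ; case: (boolP (`|a - z0| <= r)) => aJ; last first.
    by rewrite mulr0 mulr_ge0// ltW.
  have -> : `|a - z0| <= eta by rewrite (le_trans aJ)// ge_min lexx.
  rewrite mulr1 mul1r.
  have : `|f z0 - f a| < f z0 / 2.
    apply: dP; rewrite /ball/= distrC (le_lt_trans aJ)//.
    by rewrite gt_min; apply/orP; right; rewrite ltr_pdivrMr// ltr_pMr// ltr1n.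
  by rewrite ltr_norml => /andP[_]; lra.
move=> h C m mh hC m0 h0 hm.
rewrite -(weighted_scale m m1 b1).
have C0 : 0 <= C by exact: le_trans (hC 0).
apply: (@weighted_le _ _ (m + C)) => //.
- exact: measurable_funM.
- by move=> a; rewrite normrM (ger0_norm m0) (le_trans (ler_piMr _ (b1 a)))// lerDl.
- by move=> a; rewrite (le_trans (hC a))// lerDr.
- move=> a; rewrite indicE inI; case: (boolP (`|a - z0| <= eta)) => [/hm|_].
    by rewrite mulr1.
  by rewrite mulr0.
Qed.

End density.

Section fibres.
Context {R : realType}.

Lemma rseq_cons_continuous (x : rseq R) : continuous (fun a : R => rseq_cons a x).
Proof.
move=> a; apply/metricType_numDomainType.cvgrPdist_lt => e e0.
have /cvgrPdist_lt/(_ _ e0) : id @ a --> a by exact: cvg_id.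
apply: filterS => b /= ab; apply: le_lt_trans ab.
apply: le_trans (rseq_dist_coord_le (n := 0) _) _; first by case.
rewrite /= ler_pdivrMr ?mulr_gt0 ?pi_gt0// (le_trans (atan_lipschitz _ _))//.
rewrite ler_peMr// expr1 (le_trans _ (ler_wpM2r _ (pi_ge2 R)))//.
by rewrite -natrM ler1n.
Qed.

Lemma fibre_measurable (G : rseq R -> R) x : continuous G ->
  measurable_fun setT (fun a => G (rseq_cons a x)).
Proof.
move=> cG; apply: continuous_measurable_fun => a.
apply: (@continuous_comp _ _ _ (fun a : R => rseq_cons a x) G).
  exact: rseq_cons_continuous.
exact: cG.
Qed.

Lemma rseq_shift_cons a (x : rseq R) : rseq_shift (rseq_cons a x) = x.
Proof. by []. Qed.

Import HBNNSimple.

(** The integral is a supremum over simple functions below [h], each of them below [C]. This form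
    applies directly to the image of a test function under the Ruelle operator. *)
Lemma ge0_le_Rintegral_probability d (T : measurableType d) (P : probability T R)
    (h : T -> R) (C : R) : (forall x, 0 <= h x <= C) -> \int[P]_x h x <= C.
Proof.
move=> hC; have h0 x : 0 <= h x by have /andP[] := hC x.
have I0 : (0 <= \int[P]_x (h x)%:E)%E by apply: integral_ge0 => x _; rewrite lee_fin.
have IC : (\int[P]_x (h x)%:E <= C%:E)%E.
  rewrite ge0_integralTE; last by move=> x; rewrite lee_fin.
  apply: ge_ereal_sup => _ [g /= gh <-].
  rewrite -integralT_nnsfun.
  apply: (@le_trans _ _ (\int[P]_x C%:E)%E).
    apply: ge0_le_integral => //.
    - by move=> x _; rewrite lee_fin.
    - by apply/measurable_EFinP.
    - by move=> x _; rewrite (le_trans (gh x))// lee_fin; have /andP[] := hC x.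
  by rewrite integral_cst//= probability_setT mule1.
rewrite -lee_fin fineK//.
by rewrite ge0_fin_numE// (le_lt_trans IC)// ltry.
Qed.

End fibres.

Section eigenfunction.
Context {R : realType} (alpha : R).
Hypothesis alpha_gt0 : 0 < alpha.
Variable f : R -> R.
Hypothesis f_gt0 : forall a, 0 < f a.
Hypothesis f_cont : continuous f.
Hypothesis f_int : (\int[lebesgue_measure]_a (f a)%:E = 1)%E.
Variables (B psi : rseq R -> R) (lambda : R).
Hypothesis hB : holder alpha B.
Hypothesis eigen : ruelle_eigen alpha f B lambda psi.

Let lambda_gt0 : 0 < lambda. Proof. by have [] := eigen. Qed.
Let psi_gt0 x : 0 < psi x. Proof. by have [_ + _ _] := eigen; exact. Qed.
Let hpsi : holder alpha psi. Proof. by have [] := eigen. Qed.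

Definition eigen_weight (x : rseq R) (a : R) : R :=
  expR (B (rseq_cons a x)) * psi (rseq_cons a x).

Lemma eigen_eq x :
  \int[lebesgue_measure]_a (eigen_weight x a * f a) = lambda * psi x.
Proof. by have [_ _ _] := eigen; exact. Qed.

Lemma eigen_weight_measurable x : measurable_fun setT (eigen_weight x).
Proof.
apply: measurable_funM; last exact: fibre_measurable (holder_continuous alpha_gt0 hpsi).
apply: (@measurableT_comp _ _ _ _ _ _ expR) => //.
exact: fibre_measurable (holder_continuous alpha_gt0 hB).
Qed.

Lemma eigen_weight_gt0 x a : 0 < eigen_weight x a.
Proof. by rewrite mulr_gt0 ?expR_gt0. Qed.

Lemma eigen_weight_bounded : exists C : R, forall x a, `|eigen_weight x a| <= C.
Proof.
have [b b0 Hb] := holder_bounded alpha_gt0 hB.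
have [c c0 Hc] := holder_bounded alpha_gt0 hpsi.
exists (expR b * c) => x a; rewrite normrM gtr0_norm ?expR_gt0//.
by apply: ler_pM; rewrite ?expR_ge0// ler_expR (le_trans (ler_norm _)).
Qed.

(* By continuity psi is bounded below on sequences with enough coordinates near
   0; the eigenvalue equation then removes these constraints one at a time. *)
Lemma eigenfunction_inf_gt0 : exists2 c : R, 0 < c & forall x, c <= psi x.
Proof.
have [C hC] := eigen_weight_bounded.
have [b b0 Hb] := holder_bounded alpha_gt0 hB.
have psi0 : 0 < psi (fun=> 0) / 2 by rewrite divr_gt0.
have : nbhs ((fun=> 0) : rseq R) [set y | `|psi (fun=> 0) - psi y| < psi (fun=> 0) / 2].
  have /cvgrPdist_lt : psi @ ((fun=> 0) : rseq R) --> psi (fun=> 0).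
    exact: (holder_continuous alpha_gt0 hpsi).
  exact.
move=> /rseq_nbhs_cylinder[m [eta [eta0 Hm]]].
have [w w0 Hw] := window_mass f_gt0 f_cont f_int 0 eta0.
suff P k : exists2 c : R, 0 < c & forall x,
    (forall i, (i < m - k)%N -> `|x i| <= eta) -> c <= psi x.
  by have [c c0 Hc] := P m; exists c => // x; apply: Hc => i; rewrite subnn.
elim: k => [|k [c c0 Hc]].
  exists (psi (fun=> 0) / 2) => // x; rewrite subn0 => Hx.
  have : `|psi (fun=> 0) - psi x| < psi (fun=> 0) / 2.
    by apply: Hm => i im; rewrite sub0r normrN Hx.
  by rewrite ltr_norml => /andP[_]; lra.
(* Prepending a coordinate of the window shifts the constraints by one place; there the weight is at
   least [expR (- b) * c], and the window has mass [w]. *)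
exists (lambda^-1 * (expR (- b) * c * w)).
  by rewrite !mulr_gt0 ?invr_gt0 ?expR_gt0.
move=> x Hx; rewrite mulrC ler_pdivrMr// [leRHS]mulrC -eigen_eq.
apply: (Hw _ C); [exact: eigen_weight_measurable|exact: hC| | |].
- by rewrite mulr_ge0 ?expR_ge0// ltW.
- by move=> a; exact/ltW/eigen_weight_gt0.
move=> a; rewrite subr0 => aeta; apply: ler_pM; rewrite ?expR_ge0 ?(ltW c0)//.
  by rewrite ler_expR; have := Hb (rseq_cons a x); rewrite ler_norml => /andP[].
apply: Hc => -[//|i] imk; apply: Hx.
by rewrite subnS -ltnS prednK// (leq_trans _ imk).
Qed.

(** [kappa n] is the error of a replacement at place [n]; by [E_step] and [E_ge0], [E n] bounds the
    sum of the errors from place [n] on. *)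
Variables (Ua Ub : set R) (kappa E : nat -> R).
Hypothesis E_ge0 : forall n, 0 <= E n.
Hypothesis E_step : forall n, kappa n + E n.+1 <= E n.
Hypothesis B_compare : forall n (x y : rseq R), (forall k, k != n -> x k = y k) ->
  Ua (x n) -> Ub (y n) -> B x <= B y + kappa n.

(* Downward induction on n, started where the Hoelder bound on psi is
   already smaller than inf psi; each step applies the eigenvalue equation. *)
Lemma eigenfunction_compare n (x y : rseq R) : (forall k, k != n -> x k = y k) ->
  Ua (x n) -> Ub (y n) -> psi x <= 2 * expR (E n.+1) * psi y.
Proof.
have [c c0 Hc] := eigenfunction_inf_gt0.
have [C hC] := eigen_weight_bounded.
have [D D0 HD] := holder_ge0 hpsi.
have [N HN] : exists N, forall n, (N <= n)%N -> D * (2^-1 `^ alpha) ^+ n.+1 <= c.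
  have q0 : 0 <= 2^-1 `^ alpha :> R by exact: powR_ge0.
  have q1 : `|2^-1 `^ alpha| < 1 :> R.
    by rewrite ger0_norm// half_powR_lt1.
  have /cvgrPdist_lt/(_ _ c0)[N _ HN] := cvg_geometric D q1.
  exists N => k Nk; have := HN k.+1 (leq_trans Nk (leqnSn k)).
  rewrite /= sub0r normrN /geometric /= => /ltW; apply: le_trans.
  exact: ler_norm.
have base m (u v : rseq R) : (N <= m)%N -> (forall k, k != m -> u k = v k) ->
    psi u <= 2 * expR (E m.+1) * psi v.
  (* The values differ by at most [c], which is at most [psi v]. [N] depends on [psi], but the
     factor 2 enters only here and is not compounded by the induction. *)
  move=> Nm uv; have : psi u <= 2 * psi v.
    have : `|psi u - psi v| <= c.
      apply: le_trans (HD u v) _; apply: le_trans _ (HN _ Nm); rewrite ler_wpM2l//.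
      have bnd : `|atan (u m) - atan (v m)| <= pi * 1.
        rewrite mulr1 (le_trans (ler_normB _ _))//.
        by rewrite [leRHS]splitr lerD// atan_le_pihalf.
      have := half_powR alpha_gt0 m.+1 (@ler01 R) (normr_ge0 _) bnd.
      rewrite powR1 mul1r; apply: le_trans; apply: (ge0_ler_powR (ltW alpha_gt0)).
      - by rewrite nnegrE mdist_ge0.
      - by rewrite nnegrE divr_ge0// mulr_ge0 ?pi_ge0 ?exprn_ge0.
      - exact: rseq_dist_coord_le.
    by rewrite ler_norml => /andP[_]; have := Hc v; lra.
  move=> /le_trans; apply; rewrite ler_wpM2r ?(ltW (psi_gt0 _))//.
  by rewrite ler_peMr// -expR0 ler_expR.
suff step j m : (N <= m + j)%N -> forall u v : rseq R,
    (forall k, k != m -> u k = v k) -> Ua (u m) -> Ub (v m) ->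
    psi u <= 2 * expR (E m.+1) * psi v.
  by move=> xy ax by_; apply: (step N) => //; exact: leq_addl.
elim: j m => [m Nm u v uv _ _|j IH m Nm u v uv au bv].
  by apply: base => //; rewrite addn0 in Nm.
have e0 : 0 <= 2 * expR (E m.+1) by rewrite mulr_ge0 ?expR_ge0.
rewrite -(ler_pM2l lambda_gt0) mulrCA -!eigen_eq.
have bu := @eigen_weight_measurable v.
rewrite -(weighted_scale f_gt0 f_cont f_int _ bu (hC v)).
pose K := Num.max C (2 * expR (E m.+1) * C).
apply: (@weighted_le _ _ f_gt0 f_cont f_int _ _ K).
- exact: eigen_weight_measurable.
- by apply: measurable_funM => //; exact: eigen_weight_measurable.
- by move=> a; rewrite le_max hC.
- by move=> a; rewrite le_max normrM ger0_norm// ler_wpM2l ?orbT.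
move=> a.
(* Prepending [a] moves the differing place from [m] to [m.+1], so this step costs [kappa m.+1] and
   the rest [E m.+2]. *)
have cuv k : k != m.+1 -> rseq_cons a u k = rseq_cons a v k.
  by case: k => //= k; rewrite eqSS => /uv.
have h1 := B_compare cuv au bv.
have h2 : psi (rseq_cons a u) <= 2 * expR (E m.+2) * psi (rseq_cons a v).
  by apply: (IH m.+1) => //; rewrite addSnnS.
rewrite /eigen_weight; apply: (@le_trans _ _ (expR (B (rseq_cons a v) + kappa m.+1) *
    (2 * expR (E m.+2) * psi (rseq_cons a v)))).
  by apply: ler_pM; rewrite ?expR_ge0 ?(ltW (psi_gt0 _))// ler_expR.
rewrite expRD (_ : _ * _ = 2 * (expR (kappa m.+1) * expR (E m.+2)) *
  (expR (B (rseq_cons a v)) * psi (rseq_cons a v))); last by ring.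
rewrite ler_wpM2r ?mulr_ge0 ?expR_ge0 ?(ltW (psi_gt0 _))// ler_wpM2l//.
by rewrite -expRD ler_expR.
Qed.

End eigenfunction.

(** * Tail estimate for one normalized potential *)

Section tail.
Context {R : realType} (alpha : R).
Hypothesis alpha_gt0 : 0 < alpha.
Variable f : R -> R.
Hypothesis f_gt0 : forall a, 0 < f a.
Hypothesis f_cont : continuous f.
Hypothesis f_int : (\int[lebesgue_measure]_a (f a)%:E = 1)%E.

(** A continuous stand-in for the indicator of large coordinates, since duality is available for
    continuous test functions; this is why the tail is measured beyond [M + 1]. *)
Definition ramp (M t : R) : R := Num.min 1 (Num.max 0 (`|t| - M)).

Lemma ramp_bounds M t : 0 <= ramp M t <= 1.
Proof. by rewrite /ramp le_min ler01 le_max lexx ge_min lexx. Qed.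

Lemma ramp0 M t : `|t| <= M -> ramp M t = 0.
Proof.
move=> tM; rewrite /ramp max_l ?subr_le0// min_r//.
Qed.

Lemma ramp1 M t : M + 1 <= `|t| -> ramp M t = 1.
Proof.
move=> tM; have h : 1 <= `|t| - M by rewrite lerBrDl.
by rewrite /ramp max_r ?min_l// (le_trans ler01 h).
Qed.

Lemma ramp_continuous M : continuous (ramp M).
Proof.
move=> t; apply: (@continuous_min _ _ (fun=> 1) (fun t => Num.max 0 (`|t| - M))).
  exact: cvg_cst.
apply: (@continuous_max _ _ (fun=> 0) (fun t => `|t| - M)); first exact: cvg_cst.
apply: (@cvgB _ _ _ _ _ _ (fun=> M)); last exact: cvg_cst.
exact: norm_continuous.
Qed.

Variables (B psi : rseq R -> R) (lambda : R).
Hypothesis hB : holder alpha B.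
Hypothesis eigen : ruelle_eigen alpha f B lambda psi.
Variables (M z0 eta s c : R) (kappa E : nat -> R).
Hypothesis E_ge0 : forall n, 0 <= E n.
Hypothesis E_step : forall n, kappa n + E n.+1 <= E n.
Let Ua : set R := [set a | M < `|a|].
Let Ub : set R := [set b | `|b - z0| <= eta].
Hypothesis B_compare : forall n (x y : rseq R), (forall k, k != n -> x k = y k) ->
  Ua (x n) -> Ub (y n) -> B x <= B y + kappa n.
Hypothesis B_gain : forall (x y : rseq R), (forall k, k != 0 -> x k = y k) ->
  Ua (x 0) -> Ub (y 0) -> B x + E 1 + s <= B y.
Hypothesis c_gt0 : 0 < c.
Hypothesis c_window : forall (h : R -> R) (C m : R), measurable_fun setT h ->
  (forall a, `|h a| <= C) -> 0 <= m -> (forall a, 0 <= h a) ->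
  (forall a, `|a - z0| <= eta -> m <= h a) ->
  m * c <= \int[lebesgue_measure]_a (h a * f a).

Let lambda_gt0 : 0 < lambda. Proof. by have [] := eigen. Qed.
Let psi_gt0 x : 0 < psi x. Proof. by have [_ + _ _] := eigen; exact. Qed.
Let theta : R := 2 * expR (- s).

(** The weight at [a] is at most [theta] times the weight at each point of the window: [B_gain] pays
    for the factor [expR (E 1)] lost in comparing [psi]. Integrating over the window, of mass [c],
    brings in the eigenvalue. *)
Lemma eigen_weight_tail x a : M < `|a| ->
  eigen_weight B psi x a <= theta / c * (lambda * psi x).
Proof.
move=> Ma; have theta0 : 0 < theta by rewrite mulr_gt0 ?expR_gt0.
have [C hC] := eigen_weight_bounded alpha_gt0 hB eigen.
rewrite -(eigen_eq eigen) mulrAC ler_pdivlMr// -ler_pdivrMl// mulrA [_^-1 * _]mulrC.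
apply: (c_window (eigen_weight_measurable alpha_gt0 hB eigen x) (hC x)).
- exact: divr_ge0 (ltW (eigen_weight_gt0 eigen _ _)) (ltW theta0).
- by move=> b; exact/ltW/(eigen_weight_gt0 eigen).
move=> b bz; rewrite ler_pdivrMr//.
have xab k : k != 0%N -> rseq_cons a x k = rseq_cons b x k by case: k.
have h1 := B_gain xab Ma bz.
have h2 := eigenfunction_compare alpha_gt0 f_gt0 f_cont f_int hB eigen
  E_ge0 E_step B_compare xab Ma bz.
rewrite /eigen_weight.
apply: (@le_trans _ _ (expR (B (rseq_cons b x) - E 1 - s) *
    (2 * expR (E 1) * psi (rseq_cons b x)))).
  apply: ler_pM; rewrite ?expR_ge0 ?(ltW (psi_gt0 _))// ler_expR.
  by rewrite -lerBDr; lra.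
rewrite (_ : _ - _ - _ = B (rseq_cons b x) + (- s - E 1)); last by ring.
rewrite expRD expRB /theta le_eqVlt; apply/orP; left; apply/eqP.
by field; rewrite gt_eqF// expR_gt0.
Qed.

(** By duality the integral of the ramp equals that of its Ruelle image. The normalized weight is
    the eigenweight divided by [lambda * psi x], hence at most [theta / c] wherever the ramp is
    nonzero. *)
Lemma normalized_tail (mu : probability (rseq R) R) :
  ruelle_dual f (normalized_potential B lambda psi) mu mu ->
  fine (mu (outside (M + 1) 0)) <= theta / c.
Proof.
move=> dual; pose phi (x : rseq R) := ramp M (x 0).
have theta0 : 0 < theta by rewrite mulr_gt0 ?expR_gt0.
have tc0 : 0 <= theta / c by rewrite divr_ge0 ?ltW.
have cphi : continuous phi.
  move=> x; apply: (@continuous_comp _ _ _ (fun x : rseq R => x 0) (ramp M)).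
    exact: rseq_coord_continuous.
  exact: ramp_continuous.
have phi1 x : `|phi x| <= 1.
  by rewrite ger0_norm; have /andP[] := ramp_bounds M (x 0).
have bphi : bounded_fun phi.
  exists 1; split; first exact: num_real.
  by move=> r /ltW r1 x _ /=; exact: le_trans (phi1 x) _.
have mphi := rseq_continuous_measurable cphi.
apply: (@le_trans _ _ (\int[mu]_x phi x)).
  have mo := @outside_measurable R (M + 1) 0.
  have -> : fine (mu (outside (M + 1) 0)) = \int[mu]_x (\1_(outside (M + 1) 0) x : R).
    by rewrite /Rintegral integral_indic// setIT.
  apply: le_Rintegral => //.
  - apply: (@probability_integrable _ _ _ _ _ 1); first exact: measurable_indic.
    by move=> x; rewrite indicE; case: (_ \in _); rewrite ?normr1 ?normr0.
  - by apply: (@probability_integrable _ _ _ _ _ 1).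
  - move=> x _; rewrite indicE; case: (boolP (x \in _)) => [|_].
      by rewrite inE /outside /= /phi => /ltW/ramp1 ->.
    by have /andP[] := ramp_bounds M (x 0).
rewrite dual//; apply: ge0_le_Rintegral_probability => x.
have [C hC] := eigen_weight_bounded alpha_gt0 hB eigen.
have lp0 : 0 < lambda * psi x by rewrite mulr_gt0.
pose k a := eigen_weight B psi x a / (lambda * psi x) * ramp M a.
have kE a : expR (normalized_potential B lambda psi (rseq_cons a x)) *
    phi (rseq_cons a x) = k a.
  rewrite /normalized_potential rseq_shift_cons /k /eigen_weight /phi /=.
  rewrite !expRB expRD !lnK ?posrE//; field.
  by rewrite !gt_eqF.
have k0 a : 0 <= k a.
  rewrite mulr_ge0 ?divr_ge0 ?(ltW lp0) ?(ltW (eigen_weight_gt0 eigen _ _))//.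
  by have /andP[] := ramp_bounds M a.
have ktc a : k a <= theta / c.
  have [aM|Ma] := leP `|a| M; first by rewrite /k ramp0// mulr0.
  have /andP[r0 r1] := ramp_bounds M a.
  rewrite /k (le_trans (ler_piMr _ r1))//.
    by rewrite divr_ge0 ?(ltW lp0) ?(ltW (eigen_weight_gt0 eigen _ _)).
  by rewrite ler_pdivrMr// eigen_weight_tail.
rewrite /ruelle (_ : \int[_]_a _ = \int[lebesgue_measure]_a (k a * f a)); last first.
  by apply: eq_Rintegral => a _; rewrite kE.
rewrite Rintegral_ge0/=; last by move=> a _; rewrite mulr_ge0// ltW.
rewrite -[leRHS](weighted_cst f_gt0 f_cont f_int).
apply: (@weighted_le _ _ f_gt0 f_cont f_int _ _ (theta / c)) => //.
- apply: measurable_funM; last exact: continuous_measurable_fun (@ramp_continuous M).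
  by apply: measurable_funM => //; exact: (eigen_weight_measurable alpha_gt0 hB eigen).
- by move=> a; rewrite ger0_norm.
- by move=> a; rewrite ger0_norm.
Qed.

End tail.

(** * Constants uniform in beta, and the conclusion *)

Section gibbs_tail.
Context {R : realType} (alpha : R).
Hypothesis alpha_gt0 : 0 < alpha.
Variable f : R -> R.
Hypothesis f_gt0 : forall a, 0 < f a.
Hypothesis f_cont : continuous f.
Hypothesis f_int : (\int[lebesgue_measure]_a (f a)%:E = 1)%E.
Variables (A : rseq R -> R) (A' : eseq R -> R).
Hypothesis hA' : holder alpha A'.
Hypothesis A'_ext : forall x, A' (rseq_embed x) = A x.
Variable z0 : R.
Hypothesis hz0 : forall (x : eseq R) (n : nat),
  A' (eseq_set x n +oo%E) < A' (eseq_set x n z0%:E) /\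
  A' (eseq_set x n -oo%E) < A' (eseq_set x n z0%:E).

Lemma atan_near_infty (e : R) : 0 < e -> exists2 M : R, 0 <= M &
  forall a, M < `|a| -> exists2 v : \bar R, v = +oo%E \/ v = -oo%E &
    `|eatan v - atan a| <= e.
Proof.
move=> e0; have p0 : 0 < pi / 2 :> R by rewrite divr_gt0 ?pi_gt0.
pose q := Num.min e (pi / 2).
have q0 : 0 < q by rewrite lt_min e0.
have qe : q <= e by rewrite ge_min lexx.
have qp : q <= pi / 2 by rewrite ge_min lexx orbT.
exists `|tan (pi / 2 - q)| => // a Ma.
have K : atan (tan (pi / 2 - q)) = pi / 2 - q.
  by rewrite tanK// in_itv/=; apply/andP; split; lra.
have far b : `|tan (pi / 2 - q)| < b -> `|pi / 2 - atan b| <= e.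
  move=> Mb; have tb : tan (pi / 2 - q) <= b by rewrite (le_trans (ler_norm _))// ltW.
  have := le_atan tb; rewrite K => h; have h' := atan_ltpi2 b.
  by rewrite ger0_norm; lra.
have [a0|a0] := leP 0 a.
  by exists +oo%E; [left|rewrite /=; apply: far; rewrite (ger0_norm a0) in Ma].
exists -oo%E; [by right|rewrite /= distrC opprK addrC -[atan a]opprK -atanN].
by apply: far; rewrite (ltr0_norm a0) in Ma.
Qed.

Lemma gibbs_tail : exists M delta c : R, [/\ 0 <= M, 0 < delta, 0 < c &
  forall beta (mu : probability (rseq R) R), 0 < beta ->
    gibbs_state alpha f (fun x => beta * A x) mu ->
    fine (mu (outside (M + 1) 0)) <= 2 * expR (- (beta * delta)) / c].
Proof.
have [C C0 HC] := holder_ge0 hA'.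
have [d1 d10 Hd1] := compact_gap alpha_gt0 hA' (fun x => (hz0 x 0).1).
have [d2 d20 Hd2] := compact_gap alpha_gt0 hA' (fun x => (hz0 x 0).2).
pose d := Num.min d1 d2.
have d0 : 0 < d by rewrite lt_min d10.
pose r : R := 2^-1 `^ alpha.
have r0 : 0 <= r by exact: powR_ge0.
have r1 : 0 < 1 - r by rewrite subr_gt0 half_powR_lt1.
pose q := 2 * C * r.
have q0 : 0 <= q by rewrite !mulr_ge0.
(* The errors of all places add up to [q * t / (1 - r)], and [t] keeps this within half of the gap
   [d]; adding 1 to [q] covers [q = 0]. *)
pose t := d / 2 * (1 - r) / (q + 1).
have q10 : 0 < q + 1 by rewrite ltr_wpDl.
have t0 : 0 < t by rewrite /t divr_gt0// mulr_gt0// divr_gt0.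
have tq : q * t / (1 - r) <= d / 2.
  rewrite /t (_ : _ / (1 - r) = d / 2 * (q / (q + 1))); last first.
    by field; rewrite !gt_eqF.
  by rewrite ler_piMr ?(ltW (divr_gt0 d0 _))// ler_pdivrMr// mul1r lerDl.
pose rho := t `^ alpha^-1.
have rho0 : 0 < rho by exact: powR_gt0.
have rhot : rho `^ alpha = t by rewrite /rho -powRrM mulVf ?gt_eqF// powRr1// ltW.
have prho0 : 0 < pi * rho by rewrite mulr_gt0 ?pi_gt0.
have [M M0 HM] := atan_near_infty prho0.
have [c c0 Hc] := window_mass f_gt0 f_cont f_int z0 prho0.
(* The geometric tail of [kappa] from place [n] on, so that [E_step] holds with equality. *)
pose E n := 2 * C * t * r ^+ n.+1 / (1 - r).
pose kappa n := 2 * C * t * r ^+ n.+1.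
have compare v n (x y : rseq R) : (forall k, k != n -> x k = y k) ->
    `|eatan v - atan (x n)| <= pi * rho -> `|y n - z0| <= pi * rho ->
    A x <= A y + kappa n +
      (A' (eseq_set (rseq_embed x) n v) - A' (eseq_set (rseq_embed x) n z0%:E)).
  move=> xy xv yz.
  have := @coordinate_comparison R alpha alpha_gt0 A A' C C0 HC A'_ext v z0 rho n x y.
  rewrite rhot -/r; apply=> //; first exact: ltW.
  by rewrite distrC (le_trans (atan_lipschitz _ _)).
exists M, (d / 2), c; split=> //; first by rewrite divr_gt0.
move=> beta mu beta0 [lambda [psi [eigen _ dual]]].
have hB : holder alpha (fun x : rseq R => beta * A x).
  exists (beta * C) => x y; rewrite -mulrBr normrM gtr0_norm// -mulrA.
  rewrite ler_wpM2l ?(ltW beta0)// -!A'_ext.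
  exact: HC.
apply: (@normalized_tail _ _ alpha_gt0 _ f_gt0 f_cont f_int _ psi lambda hB eigen M z0
  (pi * rho) _ c (fun n => beta * kappa n) (fun n => beta * E n)) => //.
- move=> n; rewrite mulr_ge0 ?(ltW beta0)// /E divr_ge0 ?(ltW r1)//.
  exact: mulr_ge0 (mulr_ge0 (mulr_ge0 (ler0n _ _) C0) (ltW t0)) (exprn_ge0 _ r0).
- move=> n; rewrite -mulrDr ler_wpM2l ?(ltW beta0)// le_eqVlt; apply/orP; left.
  rewrite /E /kappa (exprS r n.+1); apply/eqP; field.
  by rewrite gt_eqF.
- move=> n x y xy xM yz; have [v vinf xv] := HM _ xM.
  rewrite -mulrDr ler_wpM2l ?(ltW beta0)//.
  apply: le_trans (compare v n x y xy xv yz) _; rewrite gerDl subr_le0.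
  by case: vinf => ->; apply/ltW; have [] := hz0 (rseq_embed x) n.
(* At the first place the gap is at least [d]; the errors use up at most [d / 2], leaving the gain
   [d / 2]. *)
- move=> x y xy xM yz; have [v vinf xv] := HM _ xM.
  rewrite -!mulrDr ler_wpM2l ?(ltW beta0)//.
  have h := compare v 0%N x y xy xv yz.
  have gap : A' (eseq_set (rseq_embed x) 0 v) + d <= A' (eseq_set (rseq_embed x) 0 z0%:E).
    case: vinf => ->.
      by apply: le_trans (Hd1 _); rewrite lerD2l ge_min lexx.
    by apply: le_trans (Hd2 _); rewrite lerD2l ge_min lexx orbT.
  have E0 : kappa 0%N + E 1%N = q * t / (1 - r).
    by rewrite /E /kappa /q expr1 expr2; field; rewrite gt_eqF.
  by lra.
Qed.

End gibbs_tail.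

Lemma shift_invariant_outside (R : realType) (mu : probability (rseq R) R) (M : R) k :
  shift_invariant mu -> mu (outside M k) = mu (outside M 0).
Proof.
move=> inv; elim: k => // k <-.
by rewrite -(inv _ (@outside_measurable R M k)).
Qed.

Unset Implicit Arguments.

Theorem proposition2p10 (R : realType) (alpha : R) (halpha : 0 < alpha <= 1)
    (f : R -> R) (f_gt0 : forall a, 0 < f a) (f_cont : continuous f)
    (f_int : (\int[lebesgue_measure]_a (f a)%:E = 1)%E)
    (A : rseq R -> R) (hA : holder alpha A)
    (A' : eseq R -> R) (hA' : holder alpha A')
    (A'_ext : forall x, A' (rseq_embed x) = A x)
    (z0 : R)
    (hz0 : forall (x : eseq R) (n : nat),
      A' (eseq_set x n +oo%E) < A' (eseq_set x n z0%:E) /\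
      A' (eseq_set x n -oo%E) < A' (eseq_set x n z0%:E))
    (mu : R -> probability (rseq R) R)
    (hmu : forall beta, 0 < beta ->
      gibbs_state alpha f (fun x => beta * A x) (mu beta)) :
  exists (beta_ : nat -> R) (mu_oo : probability (rseq R) R),
    [/\ forall n, 0 < beta_ n,
        beta_ n @[n --> \oo] --> +oo &
        weak_cvg (fun n => mu (beta_ n)) mu_oo].
Proof.
have /andP[alpha_gt0 _] := halpha.
have [M [delta [c [M0 delta0 c0 tail]]]] :=
  gibbs_tail alpha_gt0 f_gt0 f_cont f_int hA' A'_ext hz0.
pose b n : R := n.+1%:R.
have b0 n : 0 < b n by rewrite ltr0n.
have M10 : 0 < M + 1 by rewrite ltr_wpDl.
have tail0 k : fine (mu (b n) (outside (M + 1) k)) @[n --> \oo] --> 0.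
  (* With [b n = n + 1] the tail bound becomes a geometric sequence of ratio [q]; shift invariance
     carries it from the first coordinate to coordinate [k]. *)
  pose q : R := expR (- delta).
  have q1 : `|q| < 1 by rewrite ger0_norm ?expR_ge0// expR_lt1 oppr_lt0.
  have gq := @cvg_geometric R (2 / c * q) q q1.
  apply: (squeeze_cvgr _ (cvg_cst (0 : R)) gq); apply: nearW => n.
  have [l [psi [_ inv _]]] := hmu _ (b0 n).
  rewrite fine_ge0 ?measure_ge0//= shift_invariant_outside//.
  apply: le_trans (tail _ _ (b0 n) (hmu _ (b0 n))) _.
  by rewrite -mulrN /b expRM_natl exprS -/q mulrAC mulrA.
have [g [mu_oo [gn wc]]]  :=
  @tight_weak_cvg_subseq R (M + 1) M10 (fun n => mu (b n)) tail0.
exists (b \o g), mu_oo; split => //.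
apply/cvgryPge => K; near=> n.
apply: (@le_trans _ _ n%:R); last by rewrite /b/= ler_nat (leq_trans (gn n)).
by near: n; exact: nbhs_infty_ger.
Unshelve. all: by end_near. Qed.
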